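(* Let $D>0$ be an integer, let $n_0,\dots,n_D$ be positive integers, let $\{\sigma_i:\mathbb{R}^{n_i}\to\mathbb{R}^{n_i}\}_{i=1}^D$ be a collection of almost everywhere analytic maps, and let $\alpha\in\mathbb{R}^{n_0}$ be a vector. Define recursively, for $d=1,\dots,D$, $$f_d:\mathbb{R}^{n_1\times n_0}\times\cdots\times\mathbb{R}^{n_d\times n_{d-1}}\to\mathbb{R}^{n_d},\qquad f_1(W_1)=\sigma_1(W_1\alpha),\qquad f_d(W_1,\dots,W_d)=\sigma_d\big(W_d\,f_{d-1}(W_1,\dots,W_{d-1})\big)\ \ (d\ge 2).$$ Then $f_D$ is analytic almost everywhere and the set $\partial Z(f_D)$ has measure zero.
   Context: Measure means Lebesgue measure. Products of matrix spaces are identified with Euclidean spaces. A function $f:\mathbb{R}^p\to\mathbb{R}^q$ is analytic almost everywhere if there is an open set $U\subset\mathbb{R}^p$ whose complement has measure zero such that $f|_U$ is (real) analytic. $Z(f)=\{x: f(x)=0\}$ is the zero set of $f$ and $\partial Z(f)$ its topological boundary. *)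

(* Defs.v *)
(* MathComp-Analysis. *)
From mathcomp Require Export all_boot all_order all_algebra.
From mathcomp Require Export all_classical all_reals all_analysis.
Export Order.TTheory GRing.Theory Num.Theory.
Export numFieldNormedType.Exports.

Set Implicit Arguments.
Unset Strict Implicit.
Unset Printing Implicit Defensive.

Local Open Scope classical_set_scope.
Local Open Scope ring_scope.

(* R^p is 'cV[R]_p with the library's topology (that of the sup norm).        *)

(* The iterated product of the Lebesgue measure of R, on the product          *)
(* sigma-algebra of R^n.                                                      *)
Fixpoint lebesgue_tuple (R : realType) (n : nat) :
    set (n.-tuple (measurableTypeR R)) -> \bar R :=
  match n with
  | 0 => fun A => (\d_([tuple] : 0.-tuple (measurableTypeR R)) A)%E
  | m.+1 => fun A =>
      pushforward (@lebesgue_measure R \x @lebesgue_tuple R m)%E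
        (fun z : measurableTypeR R * m.-tuple (measurableTypeR R) =>
           [tuple of z.1 :: z.2]) A
  end.

(* Measure zero for an arbitrary set: inclusion in a Borel set of measure     *)
(* zero, i.e. measure zero for the completed measure.                         *)
Definition measure_zero (R : realType) (p : nat) (A : set 'cV[R]_p) : Prop :=
  (@lebesgue_tuple R p).-negligible
    [set t : p.-tuple (measurableTypeR R) | A (\col_i tnth t i)].

Definition monomial (R : realType) (p : nat) (k : {ffun 'I_p -> nat})
    (x : 'cV[R]_p) : R :=
  \prod_(j < p) x j ord0 ^+ k j.

(* Absolutely convergent series indexed by an unordered (countable) type.     *)
Definition has_sum (R : realType) (I : choiceType) (u : I -> R) (s : R) : Prop :=
  let v : I -> \bar R := EFin \o u in
  summable [set: I] v /\
  (\esum_(k in [set: I]) (v^\+ k) - \esum_(k in [set: I]) (v^\- k) = s%:E)%E.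

Definition analytic_at (R : realType) (p q : nat) (f : 'cV[R]_p -> 'cV[R]_q)
    (a : 'cV[R]_p) : Prop :=
  exists c : 'I_q -> {ffun 'I_p -> nat} -> R,
    \forall x \near a, forall i : 'I_q,
      has_sum (fun k => c i k * monomial k (x - a)) (f x i ord0).

(* Since U is open, analyticity of the restriction of f to U at a point of U  *)
(* is analyticity of f there.                                                 *)
Definition analytic_ae (R : realType) (p q : nat)
    (f : 'cV[R]_p -> 'cV[R]_q) : Prop :=
  exists U : set 'cV[R]_p,
    [/\ open U, measure_zero (~` U) & forall a, U a -> analytic_at f a].

Definition zero_set (R : realType) (p q : nat)
    (f : 'cV[R]_p -> 'cV[R]_q) : set 'cV[R]_p :=
  [set x | f x = 0].

Definition boundary (T : topologicalType) (A : set T) : set T :=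
  closure A `\` interior A.

(* Dimension of R^(n_1 x n_0) x ... x R^(n_d x n_(d-1)).                      *)
Fixpoint weight_dim (n : nat -> nat) (d : nat) : nat :=
  match d with
  | 0 => 0
  | e.+1 => weight_dim n e + n e.+1 * n e
  end.

(* A weight vector w lists the entries of W_1, then those of W_2, and so on,  *)
(* each matrix being read row by row: for w = (W_1, ..., W_(e+1)), usubmx w   *)
(* is (W_1, ..., W_e) and vec_mx (dsubmx w)^T is W_(e+1).                     *)
(* The value at d = 0, where there are no weights, is alpha, so that          *)
(* f_1(W_1) = sigma_1(W_1 alpha); sigma 0 is not used.                        *)
Fixpoint network (R : realType) (n : nat -> nat)
    (sigma : forall i : nat, 'cV[R]_(n i) -> 'cV[R]_(n i))
    (alpha : 'cV[R]_(n 0)) (d : nat) :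
    'cV[R]_(weight_dim n d) -> 'cV[R]_(n d) :=
  match d with
  | 0 => fun=> alpha
  | e.+1 => fun w : 'cV[R]_(weight_dim n e + n e.+1 * n e) =>
      sigma e.+1
        ((vec_mx (dsubmx w)^T : 'M[R]_(n e.+1, n e))
           *m network sigma alpha (usubmx w))
  end.

(* Main.v *)
From HB Require Import structures.
Require Import Defs.
From mathcomp Require Import measurable_realfun ring lra zify.

(** Any map f that is analytic at every point of an open set U with null
    complement has a zero set whose boundary is null.  Continuity on U puts
    the part of the boundary lying in U inside the zero set; and near such a
    point x some coordinate of f does not vanish identically, because x is not
    interior to the zero set.  A power series that is not identically zero
    near its centre has a null zero set there: in one variable its zeros are
    isolated, hence countable, and Fubini reduces several variables to one
    ([pseries_zeros_null]).  As R^p has a countable basis, these local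
    statements add up ([boundary_zero_set_null]).

    So everything reduces to the analyticity almost everywhere of f_D, which
    is proved by induction on the number of layers ([analytic_ae_layer]).
    For v != 0 the map W |-> W v is linear and onto, so it pulls null sets back
    to null sets ([matvec_null]); by Fubini, for almost every (W', W) with
    f(W') != 0 the vector W f(W') is a good point of sigma, and the next layer
    is analytic there by composition.  Where f(W') = 0 the vector W f(W') is 0,
    which may well be a bad point of sigma for every W; but in the interior of
    the zero set of f the next layer is constant, and what is left of the zero
    set is contained in its boundary, which is null by the first paragraph.
    The claim on the boundary is thus also what makes the induction work.

    The analysis is carried by one predicate, [pseries r M f]: on the closed
    polydisc of radius r around 0 the function f is the sum of a power series
    of norm sum_k |c_k| r^|k| at most M.  These functions behave as in a Banach
    algebra, and the essential closure property is composition
    ([pseries_comp]).  Besides the composition of analytic maps, it yields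
    recentring (substitute a + y) and slicing (freeze a coordinate), hence
    everything that is needed about zeros.  It rests on [pseries_regroup]: an
    absolutely convergent sum of monomials over an arbitrary index set, where
    the same monomial may occur infinitely often, is a power series. *)

Set Implicit Arguments.
Unset Strict Implicit.
Unset Printing Implicit Defensive.

Local Open Scope classical_set_scope.
Local Open Scope ring_scope.

(** * Sums of absolutely convergent families *)

Section Sums.
Variable R : realType.

Definition l1 (I : choiceType) (u : I -> R) : \bar R :=
  \esum_(k in [set: I]) `|u k|%:E.

Lemma l1_ge0 (I : choiceType) (u : I -> R) : (0 <= l1 u)%E.
Proof. by apply: esum_ge0 => k _; rewrite lee_fin. Qed.

Lemma le_l1 (I : choiceType) (u v : I -> R) :
  (forall k, `|u k| <= `|v k|) -> (l1 u <= l1 v)%E.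
Proof. by move=> uv; apply: le_esum => k _; rewrite lee_fin. Qed.

Lemma has_sum_l1 (I : choiceType) (u : I -> R) s :
  has_sum u s -> (l1 u < +oo)%E.
Proof. by case. Qed.

Lemma has_sum_unique (I : choiceType) (u : I -> R) s t :
  has_sum u s -> has_sum u t -> s = t.
Proof. by move=> [_ us] [_ ut]; have := us; rewrite ut => -[]. Qed.

Lemma eq_has_sum (I : choiceType) (u v : I -> R) s :
  u =1 v -> has_sum u s -> has_sum v s.
Proof. by move=> /funext ->. Qed.

(** Identities between sums are first proved for nonnegative families, where
    [esum] is additive without any convergence hypothesis, and then carried over
    by writing a family as a difference of two such. *)
Definition nnsum (I : choiceType) (p : I -> R) (P : R) :=
  (forall k, 0 <= p k) /\ \esum_(k in [set: I]) (p k)%:E = P%:E.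

Lemma nnsum_l1 (I : choiceType) (p : I -> R) P : nnsum p P -> l1 p = P%:E.
Proof. by case=> p0 <-; apply: eq_esum => k _; rewrite ger0_norm. Qed.

Lemma nnsumD (I : choiceType) (p q : I -> R) P Q :
  nnsum p P -> nnsum q Q -> nnsum (fun k => p k + q k) (P + Q).
Proof.
move=> [p0 pP] [q0 qQ]; split=> [k|]; first by rewrite addr_ge0.
by rewrite EFinD -pP -qQ -esumD// => k _; rewrite lee_fin.
Qed.

Lemma nnsum_fin (I : choiceType) (p : I -> R) :
  (forall k, 0 <= p k) -> (l1 p < +oo)%E -> nnsum p (fine (l1 p)).
Proof.
move=> p0 ps; split=> //; rewrite fineK; last first.
  by rewrite ge0_fin_numE// l1_ge0.
by apply: eq_esum => k _; rewrite ger0_norm.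
Qed.

Lemma has_sum_nnsumB (I : choiceType) (p q : I -> R) P Q :
  nnsum p P -> nnsum q Q -> has_sum (fun k => p k - q k) (P - Q).
Proof.
move=> np nq.
have sp : summable [set: I] (EFin \o p).
  rewrite /summable; have := nnsum_l1 np.
  by rewrite /l1 /= => ->; rewrite ltry.
have sq : summable [set: I] (EFin \o q).
  rewrite /summable; have := nnsum_l1 nq.
  by rewrite /l1 /= => ->; rewrite ltry.
have e : EFin \o (fun k => p k - q k) = ((EFin \o p) \- (EFin \o q))%E.
  by apply/funext => k /=; rewrite EFinB.
case: np nq => p0 pP [q0 qQ].
rewrite /has_sum /= e; split; first exact: summableB.
rewrite esumB// ?EFinB ?pP ?qQ // => k _; by rewrite /= lee_fin.
Qed.

(** Positive and negative parts.  The last clause says that they do not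
    overlap: where u vanishes, so do both of them. *)
Lemma l1_nnsumB (I : choiceType) (u : I -> R) : (l1 u < +oo)%E ->
  exists p q P Q, [/\ nnsum p P, nnsum q Q, forall k, u k = p k - q k &
    forall k, `|u k| = p k + q k].
Proof.
move=> us.
exists (fun k => Num.max (u k) 0), (fun k => Num.max (- u k) 0).
exists (fine (l1 (fun k => Num.max (u k) 0))).
exists (fine (l1 (fun k => Num.max (- u k) 0))).
split.
- apply: nnsum_fin => [k|]; first by rewrite le_max lexx orbT.
  apply: le_lt_trans us; apply: le_l1 => k.
  by case: (leP (u k) 0) => h; rewrite ?normr0.
- apply: nnsum_fin => [k|]; first by rewrite le_max lexx orbT.
  apply: le_lt_trans us; apply: le_l1 => k.
  by case: (leP (- u k) 0) => h; rewrite ?normr0 ?normrN.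
- move=> k; case: (lerP 0 (u k)) => h.
    by rewrite max_r ?oppr_le0// subr0.
  by rewrite max_l ?oppr_ge0 ?ltW// sub0r opprK.
- move=> k; case: (lerP 0 (u k)) => h.
    by rewrite max_r ?oppr_le0// addr0 ger0_norm.
  by rewrite max_l ?oppr_ge0 ?ltW// add0r ltr0_norm.
Qed.

Lemma has_sum_exists (I : choiceType) (u : I -> R) : (l1 u < +oo)%E ->
  exists s, has_sum u s.
Proof.
move=> /l1_nnsumB [p [q [P [Q [np nq e _]]]]]; exists (P - Q).
by apply: (eq_has_sum _ (has_sum_nnsumB np nq)) => k; rewrite e.
Qed.

Lemma has_sumP (I : choiceType) (u : I -> R) s : has_sum u s ->
  exists p q P Q,
    [/\ nnsum p P, nnsum q Q, forall k, u k = p k - q k & s = P - Q].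
Proof.
move=> h; have [p [q [P [Q [np nq e _]]]]] := l1_nnsumB (has_sum_l1 h).
exists p, q, P, Q; split=> //; apply: has_sum_unique h _.
by apply: (eq_has_sum _ (has_sum_nnsumB np nq)) => k; rewrite e.
Qed.

Lemma has_sum_abs_le (I : choiceType) (u : I -> R) s :
  has_sum u s -> (`|s|%:E <= l1 u)%E.
Proof.
move=> h; have [p [q [P [Q [np nq e e']]]]] := l1_nnsumB (has_sum_l1 h).
have -> : s = P - Q.
  apply: has_sum_unique h _.
  by apply: (eq_has_sum _ (has_sum_nnsumB np nq)) => k; rewrite e.
(* |u| = p + q, so P + Q is the norm of u *)
have nD := nnsumD np nq.
have -> : l1 u = (P + Q)%:E.
  by rewrite -(nnsum_l1 nD); apply: eq_esum => k _; rewrite -e' normr_id.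
have P0 : 0 <= P by rewrite -lee_fin -(nnsum_l1 np) l1_ge0.
have Q0 : 0 <= Q by rewrite -lee_fin -(nnsum_l1 nq) l1_ge0.
by rewrite lee_fin (le_trans (ler_normB _ _))// !ger0_norm.
Qed.

Lemma l1Z_le (I : choiceType) (a : R) (u : I -> R) :
  (l1 (fun k => a * u k)%R <= `|a|%:E * l1 u)%E.
Proof.
apply: ge_ereal_sup => _ [X [finX _] <-].
under eq_fsbigr do rewrite normrM EFinM.
rewrite -ge0_mule_fsumr; last by move=> k; rewrite lee_fin.
rewrite lee_wpmul2l//; apply: ereal_sup_ubound; exists X => //.
Qed.

Lemma l1Z (I : choiceType) (a : R) (u : I -> R) :
  l1 (fun k => a * u k)%R = (`|a|%:E * l1 u)%E.
Proof.
apply/eqP; rewrite eq_le l1Z_le /=.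
have [->|a0] := eqVneq a 0; first by rewrite normr0 mul0e l1_ge0.
have := l1Z_le a^-1 (fun k => a * u k).
under [X in l1 X]eq_fun do rewrite mulrA mulVf// mul1r.
rewrite normfV => h.
have na : (0 < `|a|%:E)%E by rewrite lte_fin normr_gt0.
apply: (le_trans (lee_wpmul2l (ltW na) h)).
by rewrite muleA -EFinM mulfV ?normr_eq0// mul1e.
Qed.

Lemma nnsumZ (I : choiceType) (a : R) (p : I -> R) P :
  0 <= a -> nnsum p P -> nnsum (fun k => a * p k) (a * P).
Proof.
move=> a0 np; split=> [k|]; first by rewrite mulr_ge0// (proj1 np).
rewrite EFinM -(nnsum_l1 np) -{2}(ger0_norm a0) -l1Z.
by apply: eq_esum => k _; rewrite ger0_norm// mulr_ge0// (proj1 np).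
Qed.

Lemma has_sumD (I : choiceType) (u v : I -> R) s t :
  has_sum u s -> has_sum v t -> has_sum (fun k => u k + v k) (s + t).
Proof.
move=> /has_sumP [p [q [P [Q [np nq e ->]]]]].
move=> /has_sumP [p' [q' [P' [Q' [np' nq' e' ->]]]]].
rewrite addrACA -opprD.
apply: (eq_has_sum _ (has_sum_nnsumB (nnsumD np np') (nnsumD nq nq'))) => k.
by rewrite e e' opprD addrACA.
Qed.

Lemma has_sumZ (I : choiceType) a (u : I -> R) s :
  has_sum u s -> has_sum (fun k => a * u k) (a * s).
Proof.
move=> /has_sumP [p [q [P [Q [np nq e ->]]]]].
have [a0|/ltW a0] := lerP 0 a.
  rewrite mulrBr.
  apply: (eq_has_sum _ (has_sum_nnsumB (nnsumZ a0 np) (nnsumZ a0 nq))) => k.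
  by rewrite e mulrBr.
have b0 : 0 <= - a by rewrite oppr_ge0.
have -> : a * (P - Q) = (- a) * Q - (- a) * P by ring.
apply: (eq_has_sum _ (has_sum_nnsumB (nnsumZ b0 nq) (nnsumZ b0 np))) => k.
by rewrite e; ring.
Qed.

Lemma l1_inj_le (I J : choiceType) (e : I -> J) (u : J -> R) :
  injective e -> (l1 (u \o e) <= l1 u)%E.
Proof.
move=> ie.
rewrite /l1 -(@esum_image _ _ _ setT e (fun j => `|u j|%:E)); last by move=> x y _ _ /ie.
rewrite esum_mkcond; apply: le_esum => j _.
by case: ifP; rewrite lee_fin.
Qed.

Lemma l1_inj (I J : choiceType) (e : I -> J) (u : J -> R) :
  injective e -> (forall j, ~ range e j -> u j = 0) -> l1 (u \o e) = l1 u.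
Proof.
move=> ie u0.
rewrite /l1 -(@esum_image _ _ _ setT e (fun j => `|u j|%:E)); last by move=> x y _ _ /ie.
rewrite esum_mkcond; apply: eq_esum => j _.
by case: ifPn => // /negP h; rewrite u0 ?normr0// => h'; apply: h; rewrite inE.
Qed.

Lemma nnsum_inj (I J : choiceType) (e : I -> J) (p : J -> R) P :
  injective e -> (forall j, ~ range e j -> p j = 0) ->
  nnsum p P -> nnsum (p \o e) P.
Proof.
move=> ie p0 np; split=> [k|]; first exact: (proj1 np).
rewrite -(nnsum_l1 np) -(l1_inj ie p0).
by apply: eq_esum => k _; rewrite ger0_norm// (proj1 np).
Qed.

Lemma has_sum_inj (I J : choiceType) (e : I -> J) (u : J -> R) s :
  injective e -> (forall j, ~ range e j -> u j = 0) ->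
  has_sum u s -> has_sum (u \o e) s.
Proof.
move=> ie u0 h; have [p [q [P [Q [np nq eu en]]]]] := l1_nnsumB (has_sum_l1 h).
have pq j : ~ range e j -> p j = 0 /\ q j = 0.
  move=> /u0 uj; have := en j; rewrite uj normr0 => /esym/eqP.
  by rewrite paddr_eq0 ?(proj1 np)// ?(proj1 nq)// => /andP [/eqP -> /eqP ->].
have -> : s = P - Q.
  apply: has_sum_unique h _.
  by apply: (eq_has_sum _ (has_sum_nnsumB np nq)) => k; rewrite eu.
have np' := nnsum_inj ie (fun j h => proj1 (pq j h)) np.
have nq' := nnsum_inj ie (fun j h => proj2 (pq j h)) nq.
by apply: (eq_has_sum _ (has_sum_nnsumB np' nq')) => k /=; rewrite eu.
Qed.

Lemma l1_pair (I J : choiceType) (v : I * J -> R) :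
  l1 v = \esum_(i in [set: I]) l1 (fun j => v (i, j)).
Proof.
rewrite /l1 esum_esum; last by move=> *; rewrite lee_fin.
have -> : [set: I] `*`` (fun _ => [set: J]) = setT by apply/seteqP; split.
by apply: eq_esum => -[].
Qed.

(** The graph of m embeds J into K * J, and a sum over K * J is an iterated
    sum. *)
Lemma l1_fibers (J K : choiceType) (m : J -> K) (u : J -> R) :
  l1 u = \esum_(k in [set: K]) l1 (fun j => if m j == k then u j else 0).
Proof.
pose v (kj : K * J) := if m kj.2 == kj.1 then u kj.2 else 0.
pose e j := (m j, j).
have ie : injective e by move=> x y [].
rewrite -(l1_pair v) -(l1_inj ie).
  by apply: eq_esum => j _; rewrite /v /= eqxx.
move=> [k j] h; rewrite /v /=; case: eqP => // mj.
by case: h; exists j => //; rewrite /e mj.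
Qed.

Lemma nnsum_fibers (J K : choiceType) (m : J -> K) (p : J -> R) P :
  nnsum p P -> exists fs : K -> R, nnsum fs P /\
    forall k, nnsum (fun j => if m j == k then p j else 0) (fs k).
Proof.
move=> np.
have h k : nnsum (fun j => if m j == k then p j else 0)
    (fine (l1 (fun j => if m j == k then p j else 0))).
  apply: nnsum_fin => [j|]; first by case: ifP => // _; rewrite (proj1 np).
  apply: le_lt_trans (_ : l1 p < +oo)%E; last by rewrite (nnsum_l1 np) ltry.
  by apply: le_l1 => j; case: ifP; rewrite ?normr0.
exists (fun k => fine (l1 (fun j => if m j == k then p j else 0))); split=> //.
split=> [k|]; first by rewrite fine_ge0// l1_ge0.
rewrite -(nnsum_l1 np) (l1_fibers m); apply: eq_esum => k _.
by rewrite -(nnsum_l1 (h k)).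
Qed.

Lemma has_sum_fibers (J K : choiceType) (m : J -> K) (u : J -> R) s :
  has_sum u s -> exists fs : K -> R, has_sum fs s /\
    forall k, has_sum (fun j => if m j == k then u j else 0) (fs k).
Proof.
move=> /has_sumP [p [q [P [Q [np nq e ->]]]]].
have [fp [np1 np2]] := nnsum_fibers m np.
have [fq [nq1 nq2]] := nnsum_fibers m nq.
exists (fun k => fp k - fq k); split; first exact: has_sum_nnsumB.
move=> k; apply: (eq_has_sum _ (has_sum_nnsumB (np2 k) (nq2 k))) => j.
by case: ifP; rewrite ?e ?subrr.
Qed.

(** By absolute convergence v has some sum t.  Grouping its terms by their
    first index gives a family of sum t, and by uniqueness of the inner sums
    this family is f. *)
Lemma has_sum_pair (I J : choiceType) (v : I * J -> R) (f : I -> R) s :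
  (l1 v < +oo)%E -> (forall i, has_sum (fun j => v (i, j)) (f i)) ->
  has_sum f s -> has_sum v s.
Proof.
move=> /has_sum_exists [t vt] vf fs.
have [g [gt gi]] := has_sum_fibers fst vt.
suff -> : s = t by [].
apply: has_sum_unique fs (eq_has_sum _ gt) => i.
have inj : injective (pair i : J -> I * J) by move=> x y [].
have := has_sum_inj inj _ (gi i) => H.
apply: has_sum_unique (eq_has_sum _ (H _)) (vf i) => [j|].
  by rewrite /= eqxx.
move=> [i' j] h; rewrite /=; case: eqP => // e; case: h.
by exists j => //; rewrite e.
Qed.

Lemma has_sumM (I J : choiceType) (u : I -> R) (v : J -> R) s t :
  has_sum u s -> has_sum v t -> has_sum (fun ij => u ij.1 * v ij.2) (s * t).
Proof.
move=> us vt; apply: (@has_sum_pair _ _ _ (fun i => u i * t)).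
- rewrite l1_pair /=.
  have [a va] : exists a, l1 v = a%:E.
    exists (fine (l1 v)); rewrite fineK// ge0_fin_numE ?l1_ge0//.
    exact: has_sum_l1 vt.
  have -> : \esum_(i in [set: I]) l1 (fun j => u i * v j)%R = l1 (fun i => a * u i)%R.
    apply: eq_esum => i _; rewrite l1Z va -EFinM normrM mulrC ger0_norm//.
    by rewrite -lee_fin -va l1_ge0.
  by rewrite l1Z lte_mul_pinfty//; exact: has_sum_l1 us.
- by move=> i /=; exact: has_sumZ.
- by rewrite mulrC; apply: (eq_has_sum _ (has_sumZ t us)) => i; rewrite mulrC.
Qed.

Lemma l1M (I J : choiceType) (u : I -> R) (v : J -> R) (a b : R) :
  (l1 u <= a%:E)%E -> (l1 v <= b%:E)%E ->
  (l1 (fun ij => u ij.1 * v ij.2)%R <= (a * b)%:E)%E.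
Proof.
move=> ua vb; rewrite l1_pair /=.
have b0 : 0 <= b by rewrite -lee_fin (le_trans (l1_ge0 v)).
apply: (@le_trans _ _ (l1 (fun i => b * u i)%R)).
  apply: le_esum => i _; rewrite l1Z normrM mulrC EFinM (ger0_norm b0).
  by rewrite lee_wpmul2l.
by rewrite l1Z ger0_norm// mulrC EFinM lee_wpmul2l// lee_fin.
Qed.

Lemma has_sum_set1 (I : choiceType) (i : I) (a : R) :
  has_sum (fun k => if k == i then a else 0) a.
Proof.
have h (b : R) : 0 <= b -> nnsum (fun k => if k == i then b else 0) b.
  move=> b0; split=> [k|]; first by case: ifP.
  rewrite -(@esum_set1 _ _ i (fun=> b%:E))//.
  rewrite [RHS]esum_mkcond; apply: eq_esum => k _.
  by case: eqP => [->|ki]; [rewrite mem_set|rewrite memNset].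
have [a0|a0] := lerP 0 a.
  rewrite -[in X in has_sum _ X](subr0 a).
  apply: (eq_has_sum _ (has_sum_nnsumB (h _ a0) (h _ (lexx 0)))) => k.
  by case: ifP; rewrite subr0.
rewrite -[in X in has_sum _ X](opprK a) -[X in has_sum _ X]sub0r.
have a1 : 0 <= - a by rewrite oppr_ge0 ltW.
apply: (eq_has_sum _ (has_sum_nnsumB (h _ (lexx 0)) (h _ a1))) => k.
by case: ifP; rewrite ?sub0r ?opprK ?oppr0.
Qed.

Lemma l1_set1 (I : choiceType) (i : I) (a : R) :
  l1 (fun k => if k == i then a else 0) = `|a|%:E.
Proof.
have := has_sum_set1 i `|a| => h.
have [_] := h.
rewrite -[X in _ = X -> _]/(`|a|%:E) => <-.
rewrite [X in (_ - X)%E]esum1 ?sube0.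
  apply: eq_esum => k _; rewrite funeposE /=.
  by case: ifP; rewrite ?normr0 ?maxxx// max_l// lee_fin.
move=> k _; rewrite funenegE /=; case: ifP => _; last first.
  by rewrite oppr0 maxxx.
by rewrite max_r// lee_fin oppr_le0.
Qed.

Lemma l1D (I : choiceType) (u v : I -> R) :
  (l1 (fun k => u k + v k)%R <= l1 u + l1 v)%E.
Proof.
rewrite /l1 -esumD//; try by move=> *; rewrite lee_fin.
by apply: le_esum => k _; rewrite -EFinD lee_fin ler_normD.
Qed.

End Sums.

(** * Power series with bounded norm on a polydisc *)

Section PowerSeries.
Variable R : realType.

Definition polydisc (p : nat) (r : R) : set 'cV[R]_p :=
  [set y | forall i, `|y i ord0| <= r].

Definition mnm_add (p : nat) (k l : {ffun 'I_p -> nat}) : {ffun 'I_p -> nat} :=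
  [ffun j => (k j + l j)%N].

Lemma monomialD p (k l : {ffun 'I_p -> nat}) (y : 'cV[R]_p) :
  monomial (mnm_add k l) y = monomial k y * monomial l y.
Proof.
by rewrite /monomial -big_split; apply: eq_bigr => j _; rewrite ffunE exprD.
Qed.

Notation weight r k := (monomial k (const_mx r)).

Lemma weight_ge0 p (r : R) (k : {ffun 'I_p -> nat}) : 0 <= r -> 0 <= weight r k.
Proof. by move=> r0; apply: prodr_ge0 => j _; rewrite mxE exprn_ge0. Qed.

Lemma weight_gt0 p (r : R) (k : {ffun 'I_p -> nat}) : 0 < r -> 0 < weight r k.
Proof. by move=> r0; apply: prodr_gt0 => j _; rewrite mxE exprn_gt0. Qed.

Lemma monomial_le p (r : R) (k : {ffun 'I_p -> nat}) y : polydisc r y ->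
  `|monomial k y| <= weight r k.
Proof.
move=> yr; rewrite normr_prod; apply: ler_prod => j _.
by rewrite mxE normr_ge0 /= normrX lerXn2r ?nnegrE// (le_trans _ (yr j)).
Qed.

Lemma polydisc_const p (r : R) : 0 <= r -> polydisc r (const_mx r : 'cV[R]_p).
Proof. by move=> r0 i; rewrite mxE ger0_norm. Qed.

Definition mnm0 p : {ffun 'I_p -> nat} := [ffun=> 0%N].

Lemma monomial0 p (y : 'cV[R]_p) : monomial (mnm0 p) y = 1.
Proof. by rewrite /monomial big1// => j _; rewrite ffunE. Qed.

Lemma mnm_neq0 p (k : {ffun 'I_p -> nat}) :
  k != mnm0 p -> exists j, k j != 0%N.
Proof.
move=> k0; apply/existsP; apply: contraNT k0; rewrite negb_exists.
move=> /forallP h; apply/eqP/ffunP => j; rewrite ffunE; apply/eqP.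
by have := h j; rewrite negbK.
Qed.

Lemma monomial_at0 p (k : {ffun 'I_p -> nat}) :
  monomial k (0 : 'cV[R]_p) = (k == mnm0 p)%:R.
Proof.
have [->|k0] := eqVneq k (mnm0 p); first by rewrite monomial0.
have [j kj] := mnm_neq0 k0.
by rewrite /monomial (bigD1 j)//= mxE expr0n (negbTE kj) mul0r.
Qed.

Lemma weight_le p (t : R) (k : {ffun 'I_p -> nat}) :
  0 <= t <= 1 -> k != mnm0 p -> weight t k <= t.
Proof.
move=> /andP [t0 t1] /mnm_neq0 [j kj].
rewrite /monomial (bigD1 j)//= mxE -[leRHS]mulr1; apply: ler_pM.
- exact: exprn_ge0.
- by apply: prodr_ge0 => i _; rewrite mxE exprn_ge0.
- by rewrite -[leRHS]expr1 ler_wiXn2l// lt0n.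
- by apply: prodr_ile1 => i _; rewrite mxE exprn_ge0//= exprn_ile1.
Qed.

Lemma weightM p (t r : R) (k : {ffun 'I_p -> nat}) :
  weight (t * r) k = weight t k * weight r k.
Proof.
by rewrite /monomial -big_split; apply: eq_bigr => j _; rewrite !mxE exprMn.
Qed.

(** M bounds the norm of the series in the Banach algebra of power series that
    converge absolutely on the polydisc.  Keeping track of it is what allows
    one series to be substituted into another. *)
Definition pseries (p : nat) (r M : R) (f : 'cV[R]_p -> R) : Prop :=
  0 < r /\ exists c : {ffun 'I_p -> nat} -> R,
    (l1 (fun k => c k * weight r k)%R <= M%:E)%E /\
    forall y, polydisc r y -> has_sum (fun k => c k * monomial k y) (f y).

Lemma pseries_norm_ge0 p r M (f : 'cV[R]_p -> R) : pseries r M f -> 0 <= M.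
Proof.
by move=> [r0 [c [cM _]]]; rewrite -lee_fin (le_trans _ cM) ?l1_ge0.
Qed.

Lemma pseries_bound p r M (f : 'cV[R]_p -> R) y :
  pseries r M f -> polydisc r y -> `|f y| <= M.
Proof.
move=> [r0 [c [cM cf]]] yr; rewrite -lee_fin.
apply: le_trans (has_sum_abs_le (cf y yr)) _.
apply: le_trans cM; apply: le_l1 => k.
by rewrite !normrM ler_wpM2l// (le_trans (monomial_le k yr))// ler_norm.
Qed.

Lemma eq_pseries p r M (f g : 'cV[R]_p -> R) :
  (forall y, polydisc r y -> f y = g y) -> pseries r M f -> pseries r M g.
Proof.
move=> fg [r0 [c [cM cf]]]; split=> //; exists c; split=> // y yr.
by rewrite -fg//; exact: cf.
Qed.

Lemma pseries_le p r M M' (f : 'cV[R]_p -> R) :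
  M <= M' -> pseries r M f -> pseries r M' f.
Proof.
move=> MM [r0 [c [cM cf]]]; split=> //; exists c; split=> //.
by rewrite (le_trans cM)// lee_fin.
Qed.

(** The analogue of the Schwarz lemma for this norm: without a constant term,
    each term gains at least one factor t. *)
Lemma pseries_shrink0 p r M t (f : 'cV[R]_p -> R) : f 0 = 0 -> 0 < t <= 1 ->
  pseries r M f -> pseries (t * r) (t * M) f.
Proof.
move=> f0 /andP [t0 t1] [r0 [c [cM cf]]]; split; first by rewrite mulr_gt0.
have c0 : c (mnm0 p) = 0.
  have h0 : polydisc r (0 : 'cV[R]_p) by move=> i; rewrite mxE normr0 ltW.
  have h1 := has_sum_set1 (mnm0 p) (c (mnm0 p)).
  rewrite -f0; apply: has_sum_unique (eq_has_sum _ h1) (cf _ h0) => k.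
  by rewrite monomial_at0; case: eqP => [->|]; rewrite ?mulr1 ?mulr0.
exists c; split=> [|y ys]; last first.
  apply: cf => i; rewrite (le_trans (ys i))// ler_piMl// ltW//.
apply: (@le_trans _ _ (l1 (fun k => t * (c k * weight r k))%R)).
  apply: le_l1 => k; rewrite weightM.
  have [->|k0] := eqVneq k (mnm0 p); first by rewrite c0 !mul0r mulr0.
  rewrite mulrCA normrM [leRHS]normrM ler_wpM2r//.
  by rewrite !ger0_norm ?weight_ge0 ?(ltW t0)// weight_le// (ltW t0).
by rewrite l1Z gtr0_norm// EFinM lee_wpmul2l// lee_fin ltW.
Qed.

(** The coefficient c_k gathers the u_j with m j = k.  It is obtained from the
    sum at the point (r, ..., r), where no monomial vanishes; at other points
    uniqueness of sums gives the same coefficient. *)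
Lemma pseries_regroup p r M (J : choiceType) (u : J -> R)
    (m : J -> {ffun 'I_p -> nat}) (f : 'cV[R]_p -> R) : 0 < r ->
  (l1 (fun j => u j * weight r (m j))%R <= M%:E)%E ->
  (forall y, polydisc r y -> has_sum (fun j => u j * monomial (m j) y) (f y)) ->
  pseries r M f.
Proof.
move=> r0 uM uf; split=> //.
have [fs [fs1 fs2]] := has_sum_fibers m (uf _ (@polydisc_const p r (ltW r0))).
have w0 k : weight r k != 0 :> R by rewrite gt_eqF// weight_gt0.
have cE k : has_sum (fun j => if m j == k then u j else 0) (fs k / weight r k).
  rewrite mulrC; apply: (eq_has_sum _ (has_sumZ (weight r k)^-1 (fs2 k))) => j.
  by case: eqP => [->|_]; rewrite ?mulr0// mulrCA mulVf ?mulr1.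
exists (fun k => fs k / weight r k); split=> [|y yr].
  apply: le_trans uM; rewrite (l1_fibers m).
  apply: le_esum => k _; rewrite divfK//.
  exact: has_sum_abs_le (fs2 k).
have [fy [fy1 fy2]] := has_sum_fibers m (uf _ yr).
apply: (eq_has_sum _ fy1) => k.
apply: has_sum_unique (fy2 k) _.
rewrite mulrC; apply: (eq_has_sum _ (has_sumZ (monomial k y) (cE k))) => j.
by case: eqP => [->|_]; rewrite ?mulr0// mulrC.
Qed.

Lemma pseries_monomial p r M a (k : {ffun 'I_p -> nat}) : 0 < r ->
  `|a| * weight r k <= M -> pseries r M (fun y => a * monomial k y).
Proof.
move=> r0 aM; split=> //; exists (fun l => if l == k then a else 0); split.
  have e : (fun l => (if l == k then a else 0) * weight r l) =
           (fun l => if l == k then a * weight r k else 0).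
    by apply/funext => l; case: eqP => [->|]; rewrite ?mul0r.
  by rewrite e l1_set1 lee_fin normrM (ger0_norm (weight_ge0 _ (ltW r0))).
move=> y yr; apply: (eq_has_sum _ (has_sum_set1 k (a * monomial k y))) => l.
by case: eqP => [->|]; rewrite ?mul0r.
Qed.

Lemma pseries_const p r M a : 0 < r -> `|a| <= M -> @pseries p r M (fun=> a).
Proof.
move=> r0 aM; apply: (@eq_pseries _ _ _ (fun y => a * monomial (mnm0 p) y)).
  by move=> y _; rewrite monomial0 mulr1.
by apply: pseries_monomial; rewrite ?monomial0 ?mulr1.
Qed.

Lemma monomial1 p (i : 'I_p) (y : 'cV[R]_p) :
  monomial [ffun j => (j == i) : nat] y = y i ord0.
Proof.
rewrite /monomial (bigD1 i)//= ffunE eqxx expr1 big1 ?mulr1// => j ji.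
by rewrite ffunE (negbTE ji).
Qed.

Lemma pseries_coord p r (i : 'I_p) :
  0 < r -> pseries r r (fun y : 'cV[R]_p => y i ord0).
Proof.
move=> r0.
apply: (@eq_pseries _ _ _ (fun y => 1 * monomial [ffun j => (j == i) : nat] y)).
  by move=> y _; rewrite mul1r monomial1.
by apply: pseries_monomial => //; rewrite normr1 mul1r monomial1 mxE.
Qed.

Lemma pseriesD p r M N (f g : 'cV[R]_p -> R) : pseries r M f -> pseries r N g ->
  pseries r (M + N) (fun y => f y + g y).
Proof.
move=> [r0 [c [cM cf]]] [_ [d [dN dg]]]; split=> //.
exists (fun k => c k + d k); split=> [|y yr].
  have e : (fun k => (c k + d k) * weight r k) =
     (fun k => c k * weight r k + d k * weight r k).
    by apply/funext => k; rewrite mulrDl.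
  by rewrite e (le_trans (l1D _ _))// EFinD leeD.
apply: (eq_has_sum _ (has_sumD (cf y yr) (dg y yr))) => k.
by rewrite mulrDl.
Qed.

Lemma pseriesM p r M N (f g : 'cV[R]_p -> R) : pseries r M f -> pseries r N g ->
  pseries r (M * N) (fun y => f y * g y).
Proof.
move=> [r0 [c [cM cf]]] [_ [d [dN dg]]].
apply: (@pseries_regroup _ _ _ _ (fun kl => c kl.1 * d kl.2)
  (fun kl => mnm_add kl.1 kl.2)) => //.
  have e : (fun kl => c kl.1 * d kl.2 * weight r (mnm_add kl.1 kl.2)) =
     (fun kl => (c kl.1 * weight r kl.1) * (d kl.2 * weight r kl.2)).
    by apply/funext => kl; rewrite monomialD mulrACA.
  by rewrite e; exact: (l1M cM dN).
move=> y yr; apply: (eq_has_sum _ (has_sumM (cf y yr) (dg y yr))) => kl.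
by rewrite monomialD mulrACA.
Qed.

Lemma pseriesX p r M (f : 'cV[R]_p -> R) n : pseries r M f ->
  pseries r (M ^+ n) (fun y => f y ^+ n).
Proof.
move=> pf; elim: n => [|n IH].
  by apply: pseries_const; rewrite ?normr1//; exact: (proj1 pf).
rewrite exprS; apply: (eq_pseries _ (pseriesM pf IH)) => y _.
by rewrite exprS.
Qed.

Lemma pseries_prod p r (I : Type) (s : seq I) (M : I -> R) (f : I -> 'cV[R]_p -> R) :
  0 < r -> (forall i, pseries r (M i) (f i)) ->
  pseries r (\prod_(i <- s) M i) (fun y => \prod_(i <- s) f i y).
Proof.
move=> r0 pf; elim: s => [|i s IH].
  rewrite big_nil; apply: (@eq_pseries _ _ _ (fun=> 1)).
    by move=> y _; rewrite big_nil.
  by apply: pseries_const; rewrite ?normr1.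
rewrite big_cons; apply: (eq_pseries _ (pseriesM (pf i) IH)) => y _.
by rewrite big_cons.
Qed.

Lemma pseries_sum p r (I : Type) (s : seq I) (M : I -> R) (f : I -> 'cV[R]_p -> R) :
  0 < r -> (forall i, pseries r (M i) (f i)) ->
  pseries r (\sum_(i <- s) M i) (fun y => \sum_(i <- s) f i y).
Proof.
move=> r0 pf; elim: s => [|i s IH].
  rewrite big_nil; apply: (@eq_pseries _ _ _ (fun=> 0)).
    by move=> y _; rewrite big_nil.
  by apply: pseries_const; rewrite ?normr0.
rewrite big_cons; apply: (eq_pseries _ (pseriesD (pf i) IH)) => y _.
by rewrite big_cons.
Qed.

(** Substitute g into each monomial y^l of h: the result has norm at most
    rho^|l|, which is the weight of the coefficient b_l in the norm of h.  Hence
    the double series over l and the monomials of x converges absolutely. *)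
Lemma pseries_comp p q r rho M (h : 'cV[R]_q -> R) (g : 'I_q -> 'cV[R]_p -> R) :
  pseries rho M h -> 0 < r -> (forall j, pseries r rho (g j)) ->
  pseries r M (fun y => h (\col_j g j y)).
Proof.
move=> [rho0 [b [bM bh]]] r0 pg.
have pm (l : {ffun 'I_q -> nat}) :
    pseries r (weight rho l) (fun y => monomial l (\col_j g j y)).
  rewrite /monomial.
  apply: (@eq_pseries _ _ _ (fun y => \prod_(j < q) g j y ^+ l j)).
    by move=> y _; apply: eq_bigr => j _; rewrite mxE.
  under eq_bigr do rewrite mxE.
  by apply: pseries_prod => // j; apply: pseriesX.
have [c cP] := @choice _ _ (fun l c =>
  (l1 (fun k => c k * weight r k)%R <= (weight rho l)%:E)%E /\
    forall y, polydisc r y ->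
      has_sum (fun k => c k * monomial k y) (monomial l (\col_j g j y)))
  (fun l => proj2 (pm l)).
have bound : (l1 (fun lk => b lk.1 * c lk.1 lk.2 * weight r lk.2)%R <= M%:E)%E.
  rewrite l1_pair /=; apply: le_trans bM.
  apply: le_esum => l _.
  have -> : (fun k => b l * c l k * weight r k) =
      (fun k => b l * (c l k * weight r k)).
    by apply/funext => k; rewrite mulrA.
  rewrite l1Z normrM EFinM lee_wpmul2l//.
  by rewrite (ger0_norm (weight_ge0 _ (ltW rho0))); exact: (proj1 (cP l)).
apply: (@pseries_regroup _ _ _ _ (fun lk => b lk.1 * c lk.1 lk.2) snd) => //.
move=> y yr.
apply: (@has_sum_pair _ _ _ _ (fun l => b l * monomial l (\col_j g j y))).
- apply: le_lt_trans (le_trans _ bound) (ltry _).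
  apply: le_l1 => lk; rewrite !normrM ler_wpM2l// ?mulr_ge0//.
  by rewrite (le_trans (monomial_le _ yr))// ler_norm.
- move=> l /=; apply: (eq_has_sum _ (has_sumZ (b l) ((proj2 (cP l)) y yr))) => k.
  by rewrite mulrA.
- apply: bh => j; rewrite mxE; exact: pseries_bound (pg j) yr.
Qed.

(** Recentring at a is the substitution of a + y, a series of norm at most
    s + e. *)
Lemma pseries_shift p r s M e (f : 'cV[R]_p -> R) (a : 'cV[R]_p) :
  pseries r M f -> polydisc s a -> 0 < e -> s + e <= r ->
  pseries e M (fun y => f (a + y)).
Proof.
move=> pf sa e0 ser.
apply: (@eq_pseries _ _ _ (fun y => f (\col_j (a j ord0 + y j ord0)))).
  by move=> y _; congr f; apply/colP => j; rewrite !mxE.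
apply: (pseries_comp pf e0) => j; apply: (pseries_le ser).
apply: pseriesD; last exact: pseries_coord.
by apply: pseries_const.
Qed.

End PowerSeries.

(** * Analytic maps *)

Section Analytic.
Variable R : realType.

Lemma nbhs_polydisc p (a : 'cV[R]_p) (A : set 'cV[R]_p) :
  nbhs a A <-> exists2 r : R, 0 < r & forall x, polydisc r (x - a) -> A x.
Proof.
split=> [/nbhs_ballP [r /= r0 rA]|[r r0 rA]].
  exists (r / 2); first by rewrite divr_gt0.
  move=> x xr; apply: rA; split=> // i j; rewrite ord1 /ball /=.
  rewrite distrC; have := xr i; rewrite !mxE => /le_lt_trans; apply.
  by rewrite ltr_pdivrMr// ltr_pMr// ltr1n.
apply/nbhs_ballP; exists r => // x [_ xr]; apply: rA => i.
by have := xr i ord0; rewrite /ball /= !mxE distrC => /ltW.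
Qed.

Lemma near_polydisc p (a : 'cV[R]_p) (r : R) : 0 < r ->
  \forall x \near a, polydisc r (x - a).
Proof. by move=> r0; apply/nbhs_polydisc; exists r. Qed.

(** Summability at the corner a + (r, ..., r) is the finiteness of the norm. *)
Lemma analytic_at_pseries p q (f : 'cV[R]_p -> 'cV[R]_q) a : analytic_at f a ->
  exists r M, 0 < r /\ forall i, pseries r M (fun y => f (a + y) i ord0).
Proof.
move=> [c /nbhs_polydisc [r r0 cf]].
pose N i := fine (l1 (fun k => c i k * monomial k (const_mx r : 'cV_p))).
have cf' y : polydisc r y ->
    forall i, has_sum (fun k => c i k * monomial k y) (f (a + y) i ord0).
  by move=> yr; have := cf (a + y); rewrite [a + y]addrC addrK; apply.
exists r, (\sum_i N i); split=> // i; split=> //; exists (c i); split.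
  have h := has_sum_l1 (cf' _ (@polydisc_const _ p r (ltW r0)) i).
  rewrite -[leLHS]fineK; last by rewrite ge0_fin_numE// l1_ge0.
  rewrite lee_fin -/(N i) (bigD1 i)//= lerDl sumr_ge0// => j _.
  by rewrite fine_ge0// l1_ge0.
by move=> y /cf'.
Qed.

Lemma pseries_analytic_at p q (f : 'cV[R]_p -> 'cV[R]_q) a :
  (forall i, exists r M, pseries r M (fun y => f (a + y) i ord0)) -> analytic_at f a.
Proof.
move=> /choice [r /choice [M pf]].
have /choice [c cP] i := proj2 (pf i).
exists c.
suff H i : \forall x \near a,
    has_sum (fun k => c i k * monomial k (x - a)) (f x i ord0).
  exact: (filter_forall _ H).
apply/nbhs_polydisc; exists (r i); first exact: (proj1 (pf i)).
move=> x xr; have := proj2 (cP i) _ xr.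
by rewrite addrCA subrr addr0.
Qed.

(** Shrink the polydisc for f - f 0, which has no constant term. *)
Lemma pseries_continuous0 p r M (f : 'cV[R]_p -> R) e : pseries r M f -> 0 < e ->
  exists2 d, 0 < d & forall y, polydisc d y -> `|f y - f 0| <= e.
Proof.
move=> pf e0; have r0 := proj1 pf.
have M0 := pseries_norm_ge0 pf.
pose N := M + `|f 0|.
have pg : pseries r N (fun y => f y - f 0).
  by apply: pseriesD => //; apply: pseries_const; rewrite ?normrN.
have N0 := pseries_norm_ge0 pg.
(* t <= 1 and t * N <= e *)
pose t := e / (e + N).
have t0 : 0 < t by rewrite divr_gt0// ltr_pwDl.
have t1 : t <= 1 by rewrite ler_pdivrMr ?mul1r ?lerDl// ltr_pwDl.
exists (t * r); first exact: mulr_gt0.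
move=> y yd; have := pseries_shrink0 (subrr _) _ pg => /(_ t).
rewrite t0 t1 => /(_ isT)/pseries_bound/(_ yd)/le_trans; apply.
by rewrite mulrAC ler_pdivrMr ?ltr_pwDl// ler_wpM2l ?(ltW e0)// lerDr ltW.
Qed.

Lemma analytic_at_continuous p q (f : 'cV[R]_p -> 'cV[R]_q) a :
  analytic_at f a -> {for a, continuous f}.
Proof.
move=> /analytic_at_pseries [r [M [r0 pf]]] A /nbhs_polydisc [e e0 eA].
suff : \forall x \near a, forall i, `|(f x - f a) i ord0| <= e.
  by apply: filterS => x /eA.
suff H i : \forall x \near a, `|(f x - f a) i ord0| <= e.
  exact: (filter_forall _ H).
have [d d0 dP] := pseries_continuous0 (pf i) e0.
apply/nbhs_polydisc; exists d => // x /dP.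
by rewrite addr0 addrCA subrr addr0 !mxE.
Qed.

Lemma analytic_at_ext p q (f g : 'cV[R]_p -> 'cV[R]_q) a :
  (\forall x \near a, f x = g x) -> analytic_at f a -> analytic_at g a.
Proof.
move=> fg [c cf]; exists c; near=> x.
have <- : f x = g x by near: x.
by near: x.
Unshelve. all: by end_near. Qed.

Lemma analytic_at_cst p q (b : 'cV[R]_q) (a : 'cV[R]_p) :
  analytic_at (fun=> b) a.
Proof.
apply: pseries_analytic_at => i; exists 1, `|b i ord0|.
exact: pseries_const.
Qed.

(** The increment of f at a has no constant term, so on a small polydisc its
    norm is at most the radius of the series of g. *)
Lemma analytic_at_comp p q m (f : 'cV[R]_p -> 'cV[R]_q)
    (g : 'cV[R]_q -> 'cV[R]_m) a :
  analytic_at f a -> analytic_at g (f a) -> analytic_at (g \o f) a.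
Proof.
move=> /analytic_at_pseries [r [M [r0 pf]]] /analytic_at_pseries [rho [N [rho0 pg]]].
apply: pseries_analytic_at => i.
have pd j : pseries r (M + `|f a j ord0|) (fun y => f (a + y) j ord0 - f a j ord0).
  by apply: pseriesD => //; apply: pseries_const; rewrite ?normrN.
pose L := \sum_j (M + `|f a j ord0|).
have Lj j : M + `|f a j ord0| <= L.
  rewrite /L (bigD1 j)//= lerDl sumr_ge0// => k _.
  exact: pseries_norm_ge0 (pd k).
have L0 : 0 <= L by apply: sumr_ge0 => j _; exact: pseries_norm_ge0 (pd j).
(* t <= 1 and t * L <= rho *)
pose t := rho / (rho + L).
have t0 : 0 < t by rewrite divr_gt0// ltr_pwDl.
have t1 : t <= 1 by rewrite ler_pdivrMr ?mul1r ?lerDl// ltr_pwDl.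
have tL : t * L <= rho.
  by rewrite mulrAC ler_pdivrMr ?ltr_pwDl// ler_wpM2l ?(ltW rho0)// lerDr ltW.
have pt j : pseries (t * r) rho (fun y => f (a + y) j ord0 - f a j ord0).
  apply: (pseries_le tL); apply: pseries_shrink0; rewrite ?t0// ?addr0 ?subrr//.
  exact: pseries_le (Lj j) (pd j).
exists (t * r), N.
apply: (eq_pseries _ (pseries_comp (pg i) (mulr_gt0 t0 r0) pt)) => y _ /=.
by congr (g _ i ord0); apply/colP => j; rewrite !mxE addrCA subrr addr0.
Qed.

End Analytic.

(** * Zeros of a power series in one variable *)

Section OneVariable.
Variable R : realType.

Lemma has_sum0 (I : choiceType) : has_sum (fun _ : I => 0 : R) 0.
Proof.
have n0 : nnsum (fun _ : I => 0 : R) 0 by split=> //; rewrite esum1.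
rewrite -[X in has_sum _ X](subrr 0).
by apply: (eq_has_sum _ (has_sum_nnsumB n0 n0)) => k; rewrite subrr.
Qed.

(** Divide the series by its lowest monomial: the quotient is again a series,
    and it does not vanish at 0. *)
Lemma pseries_isolated_zero r M (f : 'cV[R]_1 -> R) :
  pseries r M f -> (exists2 y, polydisc r y & f y != 0) ->
  exists2 d, 0 < d & forall y, polydisc d y -> y != 0 -> f y != 0.
Proof.
move=> [r0 [c [cM cf]]] [y0 y0r fy0].
pose K n : {ffun 'I_1 -> nat} := [ffun=> n].
have KE (k : {ffun 'I_1 -> nat}) : K (k ord0) = k.
  by apply/ffunP => j; rewrite ffunE (ord1 j).
have exn : exists n, c (K n) != 0.
  apply: contrapT => /forallNP h; move/negP: fy0; apply; apply/eqP.
  apply: has_sum_unique (cf _ y0r) (eq_has_sum _ (has_sum0 _)) => k.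
  by have /negP := h (k ord0); rewrite KE negbK => /eqP ->; rewrite mul0r.
(* the lowest degree that occurs in the series *)
case: (ex_minnP exn) => n cn nmin.
have inj : injective (mnm_add (K n)).
  move=> k l /ffunP e; apply/ffunP => j; have := e j; rewrite !ffunE.
  exact: addnI.
have off k : ~ range (mnm_add (K n)) k -> c k = 0.
  move=> h; apply/eqP; apply: contrapT => /negP ck.
  have := nmin (k ord0); rewrite KE => /(_ ck) nk.
  apply: h; exists (K (k ord0 - n)%N) => //.
  by apply/ffunP => j; rewrite !ffunE (ord1 j) subnKC.
have mono y : y != 0 -> monomial (K n) y != 0 :> R.
  move=> yn0; rewrite /monomial big_ord1 ffunE expf_neq0//.
  by apply: contraNneq yn0 => h; apply/eqP/colP => j; rewrite (ord1 j) mxE.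
pose g y := if y == 0 then c (K n) else f y / monomial (K n) y.
have wn0 : monomial (K n) (const_mx r : 'cV[R]_1) != 0.
  by rewrite gt_eqF// weight_gt0.
pose N := `|(monomial (K n) (const_mx r : 'cV[R]_1))^-1| * M.
have pg : pseries r N g.
  split=> //; exists (c \o mnm_add (K n)); split.
    apply: (@le_trans _ _
      (`|(monomial (K n) (const_mx r : 'cV[R]_1))^-1|%:E *
       l1 (fun k => c k * monomial k (const_mx r : 'cV[R]_1))%R)%E).
      rewrite -l1Z.
      apply: le_trans (l1_inj_le _ inj).
      apply: le_l1 => k /=.
      by rewrite monomialD mulrCA (mulrA _^-1) mulVf// mul1r.
    by rewrite EFinM lee_wpmul2l.
  move=> y yr; rewrite /g; have [->|yn0] := eqVneq y 0.
    apply: (eq_has_sum _ (has_sum_set1 (mnm0 1) (c (K n)))) => k /=.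
    rewrite monomial_at0; case: eqP => [->|_]; rewrite ?mulr0// mulr1.
    by congr c; apply/ffunP => j; rewrite !ffunE addn0.
  have h0 k : ~ range (mnm_add (K n)) k -> c k * monomial k y = 0.
    by move=> /off ->; rewrite mul0r.
  have := has_sumZ (monomial (K n) y)^-1 (has_sum_inj inj h0 (cf _ yr)).
  rewrite mulrC; apply: eq_has_sum => k /=.
  by rewrite monomialD mulrCA (mulrA _^-1) mulVf ?mono// mul1r.
have e0 : 0 < `|c (K n)| / 2 by rewrite divr_gt0// normr_gt0.
have [d d0 dP] := pseries_continuous0 pg e0; exists d => // y yd yn0.
have := dP _ yd; rewrite /g (negbTE yn0) eqxx.
apply: contraTneq => ->; rewrite mul0r sub0r normrN -ltNge.
by rewrite ltr_pdivrMr// ltr_pMr ?ltr1n// normr_gt0.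
Qed.

(** Take a = 0.  For |z| <= s, recentring gives a series around z of radius
    r - s > 2 s, which still covers the whole interval |y| <= s.  So that
    series is not identically zero, and z is at most an isolated zero. *)
Lemma pseries_zeros_countable r s M (f : 'cV[R]_1 -> R) (a : R) :
  0 < s -> 3 * s < r -> pseries r M f -> (exists2 y, polydisc s y & f y != 0) ->
  countable [set t | `|t - a| <= s /\ f (const_mx (t - a)) = 0].
Proof.
move=> s0 sr pf [y0 y0s fy0].
set Z := (X in countable X).
suff <- : isolated Z = Z by exact: countable_isolated.
apply/seteqP; split=> [|z]; first exact: isolatedS.
move=> Zz; split; first by rewrite inE.
have [zs fz] := Zz.
have zs' : polydisc s (const_mx (z - a) : 'cV[R]_1) by move=> i; rewrite mxE.
have e0 : 0 < r - s by rewrite subr_gt0; lra.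
have ser : s + (r - s) <= r by rewrite addrC subrK.
have ex : exists2 y : 'cV[R]_1, polydisc (r - s) y &
    f (const_mx (z - a) + y) != 0.
  exists (y0 - const_mx (z - a)); last by rewrite addrCA subrr addr0.
  move=> i; rewrite !mxE; apply: le_trans (ler_normB _ _) _.
  have := y0s i; lra.
have [d d0 dP] := pseries_isolated_zero (pseries_shift pf zs' e0 ser) ex.
exists [set t | `|t - z| <= d].
  apply/nbhs_ballP; exists d => // t; rewrite /ball /= distrC => /ltW.
  by [].
apply/seteqP; split=> [t [/= tz [ts ft]]|_ ->]; last first.
  by split=> //=; rewrite subrr normr0 ltW.
apply/eqP; rewrite -subr_eq0; apply: contrapT => /negP tz0.
have := dP (const_mx (t - z)).
have -> : const_mx (z - a) + const_mx (t - z) = const_mx (t - a) :> 'cV[R]_1.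
  by apply/colP => j; rewrite !mxE; ring.
rewrite ft eqxx => h; apply: notF; apply: h.
  by move=> i; rewrite mxE.
by apply: contraNneq tz0 => /colP/(_ ord0); rewrite !mxE => ->.
Qed.

End OneVariable.

(** * Sigma-finiteness and Fubini for the measure on tuples *)

Section Pushforward.
Context d1 d2 (T1 : measurableType d1) (T2 : measurableType d2) (R : realType).
Variables (mu : {measure set T1 -> \bar R}) (f : T1 -> T2) (g : T2 -> T1).
Hypotheses (mf : measurable_fun setT f) (mg : measurable_fun setT g).
Hypothesis fK : cancel f g.
Hypothesis mu_sigma_finite : sigma_finite setT mu.

Let nu : set T2 -> \bar R := pushforward mu f.

Let nu0 : nu set0 = 0. Proof. exact: measure0. Qed.

Let nu_ge0 A : (0 <= nu A)%E. Proof. exact: measure_ge0. Qed.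

Let nu_sigma_additive : semi_sigma_additive nu.
Proof. exact: measure_semi_sigma_additive. Qed.

HB.instance Definition _ :=
  isMeasure.Build _ _ _ nu nu0 nu_ge0 nu_sigma_additive.

Let nu_sigma_finite : sigma_finite setT nu.
Proof.
have [F FT Ffin] := mu_sigma_finite.
exists (fun n => g @^-1` F n).
  by rewrite -preimage_bigcup -FT preimage_setT.
move=> n; have [mF Foo] := Ffin n; split.
  by rewrite -[X in measurable X]setTI; exact: mg.
rewrite /nu /pushforward -comp_preimage.
by have -> : g \o f = id; [apply/funext => x /=; rewrite fK|].
Qed.

HB.instance Definition _ := Measure_isSigmaFinite.Build _ _ _ nu nu_sigma_finite.

Lemma pushforward_sigma_finite :
  exists nu' : {sigma_finite_measure set T2 -> \bar R},
    (nu' : set T2 -> \bar R) = pushforward mu f.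
Proof. by exists nu. Qed.

End Pushforward.

Lemma sigma_finite_prod d1 d2 (T1 : measurableType d1) (T2 : measurableType d2)
    (R : realType) (m1 : {sigma_finite_measure set T1 -> \bar R})
    (m2 : {sigma_finite_measure set T2 -> \bar R}) :
  sigma_finite [set: T1 * T2] (m1 \x m2)%E.
Proof.
have /sigma_finiteP [F [FT Fle Ffin]] := sigma_finiteT m1.
have /sigma_finiteP [G [GT Gle Gfin]] := sigma_finiteT m2.
exists (fun k => F k `*` G k); last first.
  move=> k; have [mF Foo] := Ffin k; have [mG Goo] := Gfin k.
  split; first exact: measurableX.
  by rewrite product_measure1E// lte_mul_pinfty// ge0_fin_numE.
apply/seteqP; split=> // -[x y] _.
have [i _ Fx] : (\bigcup_k F k) x by rewrite -FT.
have [j _ Gy] : (\bigcup_k G k) y by rewrite -GT.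
exists (i + j)%N => //; split=> /=.
- by have /subsetPset := Fle _ _ (leq_addr j i); apply.
- by have /subsetPset := Gle _ _ (leq_addl i j); apply.
Qed.

Section Null.
Variable R : realType.
Notation MR := (measurableTypeR R).
Notation leb := (@lebesgue_measure R).

(** The iterated product is built as a bare set function; Fubini needs it as a
    sigma-finite measure. *)
Lemma lebesgue_tuple_measure n :
  exists nu : {sigma_finite_measure set (n.-tuple MR) -> \bar R},
    (nu : set (n.-tuple MR) -> \bar R) = @lebesgue_tuple R n.
Proof.
elim: n => [|n [nu nuE]].
  by exists (\d_([tuple] : 0.-tuple MR)).
have mc : measurable_fun [set: MR * n.-tuple MR]
    (fun z => [tuple of z.1 :: z.2] : n.+1.-tuple MR).
  exact: measurable_cons.
have mh : measurable_fun [set: n.+1.-tuple MR]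
    (fun t => (thead t, [tuple of behead t]) : MR * n.-tuple MR).
  apply/measurable_fun_pairP; split; last exact: measurable_behead.
  exact: measurable_tnth.
pose m2 : {measure set (MR * n.-tuple MR)%type -> \bar R} := (leb \x nu)%E.
have [||nu' nu'E] := @pushforward_sigma_finite _ _ _ _ R m2 _ _ mc mh.
- by move=> [x t] /=; rewrite theadE; congr (_, _); apply/val_inj.
- exact: sigma_finite_prod.
by exists nu'; rewrite nu'E /= nuE.
Qed.

Definition cv_of_tuple n (t : n.-tuple MR) : 'cV[R]_n := \col_i tnth t i.

(** Borel sets of R^n, read on the tuples that carry the measure. *)
Definition measurable_cv n (A : set 'cV[R]_n) := measurable (@cv_of_tuple n @^-1` A).

Definition cons_cv n (x : R) (y : 'cV[R]_n) : 'cV[R]_n.+1 :=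
  col_mx (x%:M : 'cV_1) y.

Lemma cv_of_tuple_cons n x (t : n.-tuple MR) :
  cv_of_tuple [tuple of x :: t] = cons_cv x (cv_of_tuple t).
Proof.
apply/colP => i; rewrite !mxE; case: (splitP (i : 'I_(1 + n))) => j ij.
  rewrite !mxE ord1 eqxx mulr1n; rewrite ord1 in ij.
  by have -> : i = ord0 by apply/val_inj.
rewrite !mxE; have -> : i = lift ord0 j by apply/val_inj; rewrite /= ij.
by rewrite tnthS.
Qed.

Lemma cv_of_tuple_surj n (y : 'cV[R]_n) : exists t, cv_of_tuple t = y.
Proof.
exists [tuple (y i ord0 : MR) | i < n]; apply/colP => i.
by rewrite mxE tnth_mktuple.
Qed.

Lemma measurable_cv_slice n (A : set 'cV[R]_n.+1) x :
  measurable_cv A -> measurable_cv [set y | A (cons_cv x y)].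
Proof.
move=> mA; rewrite /measurable_cv.
have -> : @cv_of_tuple n @^-1` [set y | A (cons_cv x y)] =
   (fun t : n.-tuple MR => [tuple of x :: t] : n.+1.-tuple MR) @^-1`
   (@cv_of_tuple n.+1 @^-1` A).
  by apply/seteqP; split=> t /=; rewrite cv_of_tuple_cons.
rewrite -[X in measurable X]setTI.
by apply: (@measurable_cons _ _ _ MR (cst (x : MR)) n id).
Qed.

(** The measure of A is the integral of the measures of its slices. *)
Lemma measure_zero_fubini n (A : set 'cV[R]_n.+1) : measurable_cv A ->
  measure_zero A <->
  leb.-negligible [set x : MR | ~ measure_zero [set y | A (cons_cv x y)]].
Proof.
move=> mA.
have [nu nuE] := lebesgue_tuple_measure n.
have [nu1 nu1E] := lebesgue_tuple_measure n.+1.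
pose B := (fun z : MR * n.-tuple MR =>
  [tuple of z.1 :: z.2] : n.+1.-tuple MR) @^-1` (@cv_of_tuple n.+1 @^-1` A).
have zE (x : MR) : measure_zero [set y | A (cons_cv x y)] <->
    nu (xsection B x) = 0.
  rewrite /measure_zero -nuE.
  have -> : xsection B x = @cv_of_tuple n @^-1` [set y | A (cons_cv x y)].
    by apply/seteqP; split=> t; rewrite /xsection /= inE /B /= cv_of_tuple_cons.
  exact: (negligibleP nu (measurable_cv_slice x mA)).
have mB : measurable B.
  by rewrite -[X in measurable X]setTI; exact: measurable_cons.
have h : measure_zero A <-> @lebesgue_tuple R n.+1 (@cv_of_tuple n.+1 @^-1` A) = 0.
  by rewrite /measure_zero -nu1E; exact: negligibleP.
apply: (iff_trans h); rewrite /= /pushforward /product_measure1 -nuE.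
rewrite -/B.
have mphi := measurable_fun_xsection nu mB.
have e : (\int[leb]_x (nu \o xsection B) x = \int[leb]_x `|(nu \o xsection B) x|)%E.
  by apply: eq_integral => x _; rewrite gee0_abs.
rewrite e; apply: iff_trans (ae_eq_integral_abs _ measurableT mphi) _.
split; apply: negligibleS => x /= nx h'; apply: nx.
  by apply/zE; exact: h'.
by move=> _; exact/zE.
Qed.

End Null.

(** * Null sets of R^n *)

Section Geometry.
Variable R : realType.
Notation MR := (measurableTypeR R).
Notation leb := (@lebesgue_measure R).

Lemma measure_zeroS n (A B : set 'cV[R]_n) :
  A `<=` B -> measure_zero B -> measure_zero A.
Proof.
rewrite /measure_zero; have [nu <-] := lebesgue_tuple_measure R n.
by move=> AB; apply: negligibleS => t; exact: AB.
Qed.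

Lemma measure_zero0 n : measure_zero (set0 : set 'cV[R]_n).
Proof.
rewrite /measure_zero; have [nu <-] := lebesgue_tuple_measure R n.
exact: negligible_set0.
Qed.

Lemma measure_zeroU n (A B : set 'cV[R]_n) :
  measure_zero A -> measure_zero B -> measure_zero (A `|` B).
Proof.
rewrite /measure_zero; have [nu <-] := lebesgue_tuple_measure R n.
exact: negligibleU.
Qed.

Lemma measure_zero_bigcup n (J : countType) (P : set J) (F : J -> set 'cV[R]_n) :
  (forall j, P j -> measure_zero (F j)) -> measure_zero (\bigcup_(j in P) F j).
Proof.
move=> F0.
pose G k := if (unpickle k : option J) is Some j then
  [set x | P j /\ F j x] else set0.
apply: (@measure_zeroS _ _ (\bigcup_k G k)).
  move=> x [j Pj Fx]; exists (pickle j) => //.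
  by rewrite /G pickleK.
have : forall k, measure_zero (G k).
  move=> k; rewrite /G; case: unpickle => [j|]; last exact: measure_zero0.
  have [Pj|nPj] := pselect (P j).
    by apply: measure_zeroS (F0 j Pj) => x [].
  by apply: measure_zeroS (measure_zero0 n) => x [].
rewrite /measure_zero; have [nu <-] := lebesgue_tuple_measure R n.
move=> G0; apply: (negligibleS _ (negligible_bigcup G0)).
by move=> t [k _ Gk]; exists k.
Qed.

Lemma measure_zero_hull n (A : set 'cV[R]_n) : measure_zero A ->
  exists B, [/\ measurable_cv B, measure_zero B & A `<=` B].
Proof.
move=> [B [mB B0 AB]].
have inj : injective (@cv_of_tuple R n).
  move=> s t /colP st; apply: eq_from_tnth => i.
  by have := st i; rewrite !mxE.
exists (@cv_of_tuple R n @` B).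
have e : @cv_of_tuple R n @^-1` (@cv_of_tuple R n @` B) = B.
  apply/seteqP; split=> [t [s Bs e]|t Bt].
    by rewrite -(inj _ _ e).
  by exists t.
split; first by rewrite /measurable_cv e.
- rewrite /measure_zero.
  rewrite (_ : [set t | _] = B); last exact: e.
  by exists B; split.
- move=> y Ay; have [t ty] := cv_of_tuple_surj y; exists t => //.
  by apply: AB; rewrite /= -/(cv_of_tuple t) ty.
Qed.

(** R^0 is a single point, of mass one. *)
Lemma measure_zero_dim0 (A : set 'cV[R]_0) y : measure_zero A -> ~ A y.
Proof.
move=> /measure_zero_hull [B [mB B0 AB]] /AB By.
have : @lebesgue_tuple R 0 (@cv_of_tuple R 0 @^-1` B) = 0.
  have [nu nuE] := lebesgue_tuple_measure R 0.
  by move: B0; rewrite /measure_zero -nuE => /(negligibleP nu mB).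
rewrite /= diracE mem_set /=; first by move/eqP; rewrite onee_eq0.
suff -> : cv_of_tuple [tuple] = y by [].
by apply/colP => -[].
Qed.

(** The boxes with rational centre and radius 1/(k+1) form a countable basis. *)
Definition ratbox n (ce : 'cV[rat]_n * nat) : set 'cV[R]_n :=
  [set y | forall i, `|y i ord0 - ratr (ce.1 i ord0)| < ce.2.+1%:R^-1].

Lemma ratbox_basis n (x : 'cV[R]_n) (N : set 'cV[R]_n) : nbhs x N ->
  exists ce, ratbox ce x /\ ratbox ce `<=` N.
Proof.
move=> /nbhs_polydisc [r r0 rN].
have [k k0] : exists k, (k.+1%:R^-1 : R) < r / 2.
  have [k _ kP] := near_infty_natSinv_lt (PosNum (divr_gt0 r0 (ltr0n R 2))).
  by exists k; exact: (kP k (leqnn k)).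
have k1 : 0 < k.+1%:R^-1 :> R by rewrite invr_gt0.
have /choice [q qP] (i : 'I_n) : exists q : rat, `|x i ord0 - ratr q| < k.+1%:R^-1.
  have [|q] := @rat_in_itvoo R (x i ord0 - k.+1%:R^-1) (x i ord0 + k.+1%:R^-1).
    by rewrite ltrD2l (lt_trans _ k1)// oppr_lt0.
  rewrite in_itv /= => /andP [h1 h2]; exists q.
  move: h1 h2; set w := k.+1%:R^-1 => h1 h2.
  by rewrite ltr_norml; apply/andP; split; lra.
exists (\col_i q i, k); split=> [i|y yb].
  by rewrite mxE; exact: qP.
apply: rN => i; rewrite !mxE.
have := yb i; rewrite /= mxE => h1; have h2 := qP i.
rewrite -(subrKA (ratr (q i))) (le_trans (ler_normD _ _))//.
rewrite (distrC (ratr _)) ltW// (lt_trans (ltrD h1 h2))//.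
by move: k0; set w := k.+1%:R^-1 => k0; lra.
Qed.

Lemma measurable_coord n (i : 'I_n) :
  measurable_fun [set: n.-tuple MR] (fun t => cv_of_tuple t i ord0 : MR).
Proof.
have -> : (fun t : n.-tuple MR => cv_of_tuple t i ord0 : MR) = (@tnth n MR ^~ i).
  by apply/funext => t; rewrite mxE.
exact: measurable_tnth.
Qed.

Lemma measurable_cv_ratbox n (ce : 'cV[rat]_n * nat) : measurable_cv (ratbox ce).
Proof.
have -> : ratbox ce = \bigcap_(i in [set: 'I_n])
    [set y | ball (ratr (ce.1 i ord0) : R) ce.2.+1%:R^-1 (y i ord0)].
  apply/seteqP; split=> [y h i _|y h i].
    by rewrite /= /ball /= distrC; exact: h.
  by have := h i I; rewrite /= /ball /= distrC.
rewrite /measurable_cv preimage_bigcap; apply: fin_bigcap_measurable => // i _.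
rewrite -[X in measurable X]setTI.
have := @measurable_coord n i measurableT (ball (ratr (ce.1 i ord0) : R) ce.2.+1%:R^-1).
by apply; exact: measurable_ball.
Qed.

Lemma measurable_cv_open n (U : set 'cV[R]_n) : open U -> measurable_cv U.
Proof.
move=> oU.
pose P := [set ce : 'cV[rat]_n * nat | ratbox ce `<=` U].
have -> : U = \bigcup_ce [set x | P ce /\ ratbox ce x].
  apply/seteqP; split=> [x Ux|x [ce _ [h /h]] //].
  have [ce [cex ceU]] := ratbox_basis (open_nbhs_nbhs (conj oU Ux)).
  by exists ce.
rewrite /measurable_cv preimage_bigcup; apply: countable_bigcupT_measurable => // ce.
have [h|h] := pselect (P ce).
  have -> : [set x | P ce /\ ratbox ce x] = ratbox ce.
    by apply/seteqP; split=> x // [].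
  exact: measurable_cv_ratbox.
have -> : [set x | P ce /\ ratbox ce x] = set0 by apply/seteqP; split=> x // [].
by rewrite preimage_set0; exact: measurable0.
Qed.

Lemma measurable_cvC n (U : set 'cV[R]_n) : measurable_cv U -> measurable_cv (~` U).
Proof. by move=> mU; rewrite /measurable_cv preimage_setC; exact: measurableC. Qed.

(** The Lindelof property, through the countable basis of rational boxes. *)
Lemma measure_zero_local n (A : set 'cV[R]_n) :
  (forall x, A x -> exists2 N, nbhs x N & measure_zero (A `&` N)) ->
  measure_zero A.
Proof.
move=> h.
apply: (@measure_zeroS _ _ (\bigcup_(ce in [set ce | measure_zero (A `&` ratbox ce)])
   (A `&` ratbox ce))); last by apply: measure_zero_bigcup.
move=> x Ax; have [N xN AN] := h x Ax.
have [ce [xce ceN]] := ratbox_basis xN.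
exists ce => //=; apply: measure_zeroS AN; exact: setIS.
Qed.

Lemma cons_cv0 n x (y : 'cV[R]_n) j : cons_cv x y ord0 j = x.
Proof.
by rewrite mxE; case: splitP => // k _; rewrite mxE !ord1 eqxx.
Qed.

Lemma cons_cvS n x (y : 'cV[R]_n) i j : cons_cv x y (lift ord0 i) j = y i j.
Proof.
rewrite mxE; case: splitP => k /=; first by rewrite ord1.
by rewrite /bump /= => -[ik]; congr (y _ _); apply/val_inj.
Qed.

Lemma cons_cv_col_mx a b x (y : 'cV[R]_a) (z : 'cV[R]_b) :
  cons_cv x (col_mx y z) = col_mx (cons_cv x y) z :> 'cV_(a.+1 + b).
Proof.
apply/matrixP => i c; rewrite [RHS]mxE.
have [k ->|->] := unliftP ord0 (i : 'I_(a + b).+1); last first.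
  rewrite cons_cv0; case: splitP => // j j0.
  by have -> : j = ord0 by [apply/val_inj]; rewrite cons_cv0.
rewrite cons_cvS mxE; case: splitP => j kj; case: splitP => l; rewrite /= /bump /= kj.
- move=> jl; have -> : l = lift ord0 j by apply/val_inj.
  by rewrite cons_cvS.
- by move=> jl; exfalso; have := ltn_ord j; lia.
- by move=> jl; exfalso; have := ltn_ord l; lia.
- by move=> jl; congr (z _ _); apply/val_inj => /=; lia.
Qed.

(** One coordinate of the first factor at a time: almost every slice of N is
    null, so the induction hypothesis applies to almost every slice of A. *)
Lemma measure_zero_prod a b (A : set 'cV[R]_(a + b)) (N : set 'cV[R]_a) :
  measurable_cv A -> measure_zero N ->
  (forall x, ~ N x -> measure_zero [set y | A (col_mx x y)]) ->
  measure_zero A.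
Proof.
elim: a A N => [|a IH] A N mA /measure_zero_hull [N' [mN' N'0 NN']] AN.
  have := AN 0 (contra_not (@NN' 0) (@measure_zero_dim0 _ 0 N'0)).
  apply: measure_zeroS => y Ay /=.
  suff -> : col_mx (0 : 'cV_0) y = y by [].
  apply/colP => i; rewrite mxE; case: splitP => [[]//|j ij].
  by congr (y _ _); apply/val_inj.
apply/(@measure_zero_fubini R (a + b) A mA).
have /(measure_zero_fubini mN') := N'0.
apply: negligibleS => x /= nAx N'x; apply: nAx.
apply: (IH _ _ (measurable_cv_slice x mA) N'x) => y nN'y.
apply: measure_zeroS (AN (cons_cv x y) _) => [z /=|/NN' //].
by rewrite cons_cv_col_mx.
Qed.

End Geometry.

(** * Null zero sets *)

Section ZeroSet.
Variable R : realType.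
Notation MR := (measurableTypeR R).
Notation leb := (@lebesgue_measure R).

Definition behead_cv n (y : 'cV[R]_n.+1) : 'cV[R]_n := \col_i y (lift ord0 i) ord0.

Lemma cons_cvE n (y : 'cV[R]_n.+1) : y = cons_cv (y ord0 ord0) (behead_cv y).
Proof.
apply/colP => i; have [k ->|->] := unliftP ord0 i; first by rewrite cons_cvS mxE.
by rewrite cons_cv0.
Qed.

Lemma cons_cvB n x (y : 'cV[R]_n) (a : 'cV[R]_n.+1) :
  cons_cv x y - a = cons_cv (x - a ord0 ord0) (y - behead_cv a).
Proof.
apply/colP => i; have [k ->|->] := unliftP ord0 i.
  by rewrite mxE !cons_cvS !mxE.
by rewrite mxE !cons_cv0 mxE.
Qed.

Lemma polydisc_cons_cv n s x (y : 'cV[R]_n) :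
  polydisc s (cons_cv x y) <-> `|x| <= s /\ polydisc s y.
Proof.
split=> [h|[xs ys] i].
  split=> [|i]; first by have := h ord0; rewrite cons_cv0.
  by have := h (lift ord0 i); rewrite cons_cvS.
by have [k ->|->] := unliftP ord0 i; rewrite ?cons_cvS ?cons_cv0.
Qed.

Lemma pseries_head n r M (F : 'cV[R]_n.+1 -> R) (z : 'cV[R]_n) :
  polydisc r z -> pseries r M F ->
  pseries r M (fun u : 'cV[R]_1 => F (cons_cv (u ord0 ord0) z)).
Proof.
move=> zr pF; have r0 := proj1 pF.
pose g (i : 'I_n.+1) (u : 'cV[R]_1) := cons_cv (u ord0 ord0) z i ord0.
apply: (eq_pseries _ (pseries_comp (g := g) pF r0 _)).
  by move=> y _; congr F; apply/colP => i; rewrite mxE.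
move=> i; rewrite /g; have [k ->|->] := unliftP ord0 i.
  apply: (@eq_pseries _ _ _ _ (fun=> z k ord0)); last exact: pseries_const.
  by move=> y _; rewrite cons_cvS.
apply: (@eq_pseries _ _ _ _ (fun u => u ord0 ord0)); last exact: pseries_coord.
by move=> y _; rewrite cons_cv0.
Qed.

Lemma pseries_tail n r M (F : 'cV[R]_n.+1 -> R) t :
  `|t| <= r -> pseries r M F -> pseries r M (fun y : 'cV[R]_n => F (cons_cv t y)).
Proof.
move=> tr pF; have r0 := proj1 pF.
pose g (i : 'I_n.+1) (y : 'cV[R]_n) := cons_cv t y i ord0.
apply: (eq_pseries _ (pseries_comp (g := g) pF r0 _)).
  by move=> y _; congr F; apply/colP => i; rewrite mxE.
move=> i; rewrite /g; have [k ->|->] := unliftP ord0 i.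
  apply: (@eq_pseries _ _ _ _ (fun y => y k ord0)); last exact: pseries_coord.
  by move=> y _; rewrite cons_cvS.
apply: (@eq_pseries _ _ _ _ (fun=> t)); last exact: pseries_const.
by move=> y _; rewrite cons_cv0.
Qed.

(** Inside the larger polydisc F is continuous at every point, by recentring. *)
Lemma closed_zero_polydisc n r s M (F : 'cV[R]_n -> R) a :
  s < r -> pseries r M F ->
  closed [set x | polydisc s (x - a) /\ F (x - a) = 0].
Proof.
move=> sr pF; rewrite -[X in closed X]setCK; apply: open_closedC.
rewrite openE => x /= nx.
have [xs|xs] := pselect (polydisc s (x - a)); last first.
  move: xs => /existsNP [i /negP].
  rewrite -ltNge !mxE => h.
  have d0 : 0 < (`|x i ord0 - a i ord0| - s) / 2 by rewrite divr_gt0// subr_gt0.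
  apply/nbhs_polydisc; exists ((`|x i ord0 - a i ord0| - s) / 2) => //.
  move=> y yx [/(_ i)]; rewrite !mxE => ya _.
  have := yx i; rewrite !mxE => h2.
  have := ler_distD (y i ord0) (x i ord0) (a i ord0).
  rewrite (distrC (x i ord0) (y i ord0)) => h3; lra.
have {nx}Fx : F (x - a) <> 0 by move=> Fx; apply: nx.
have rs : 0 < r - s by rewrite subr_gt0.
have ser : s + (r - s) <= r by rewrite addrC subrK.
have F0 : 0 < `|F (x - a)| / 2 by rewrite divr_gt0// normr_gt0; apply/eqP.
have [d d0 dP] := pseries_continuous0 (pseries_shift pF xs rs ser) F0.
apply/nbhs_polydisc; exists d => // y /dP.
have -> : x - a + (y - x) = y - a by rewrite addrC addrA subrK.
rewrite addr0 => h [_ Fy]; move: h.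
rewrite Fy sub0r normrN; lra.
Qed.

(** Let F (y0, y') != 0.  In the first variable t, the series F (t, y') has at
    most countably many zeros; for every other t the slice F (t, .) is not
    identically zero, and its zero set is null by induction. *)
Lemma pseries_zeros_null n r s M (F : 'cV[R]_n -> R) a :
  0 < s -> 3 * s < r -> pseries r M F -> (exists2 y, polydisc s y & F y != 0) ->
  measure_zero [set x | polydisc s (x - a) /\ F (x - a) = 0].
Proof.
move=> s0 sr; have sr' : s < r by lra.
elim: n F a => [|n IH] F a pF [y ys Fy].
  apply: measure_zeroS (measure_zero0 R 0) => x [_].
  have -> : x - a = y by apply/colP => -[].
  by move/eqP; rewrite (negbTE Fy).
have cS := closed_zero_polydisc (a := a) sr' pF.
have mS : measurable_cv [set x | polydisc s (x - a) /\ F (x - a) = 0].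
  rewrite -[X in measurable_cv X]setCK.
  apply: measurable_cvC; apply: measurable_cv_open.
  exact: closed_openC.
apply/(measure_zero_fubini mS).
rewrite (cons_cvE y) in ys Fy; move/polydisc_cons_cv: ys => [y0s y's].
pose f (u : 'cV[R]_1) := F (cons_cv (u ord0 ord0) (behead_cv y)).
have pf : pseries r M f.
  by apply: pseries_head pF => i; rewrite (le_trans (y's i))// ltW.
have ex : exists2 u, polydisc s u & f u != 0.
  exists (const_mx (y ord0 ord0)); first by move=> i; rewrite mxE.
  by rewrite /f mxE.
have cnt := pseries_zeros_countable (a ord0 ord0) s0 sr pf ex.
exists [set t | `|t - a ord0 ord0| <= s /\ f (const_mx (t - a ord0 ord0)) = 0].
split.
- by apply: countable_measurable => // t; exact: measurable_set1.
- exact: countable_lebesgue_measure0.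
move=> t /= nt; apply: contrapT => h; apply: nt.
have [ts|ts] := pselect (`|t - a ord0 ord0| <= s); last first.
  apply: measure_zeroS (measure_zero0 R n) => z /=.
  by rewrite cons_cvB => -[/polydisc_cons_cv [/ts]].
have Fn : f (const_mx (t - a ord0 ord0)) != 0 by apply/eqP => e; apply: h.
have tr : `|t - a ord0 ord0| <= r by lra.
have := IH _ (behead_cv a) (pseries_tail tr pF).
have ex' : exists2 y, polydisc s y & F (cons_cv (t - a ord0 ord0) y) != 0.
  by exists (behead_cv y) => //; move: Fn; rewrite /f mxE.
move=> /(_ ex'); apply: measure_zeroS => z /=.
by rewrite cons_cvB => -[/polydisc_cons_cv [_ zs] Fz].
Qed.

(** Near a point x of the boundary where f is analytic, f is not identically
    zero, and being continuous it vanishes on its boundary points. *)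
Lemma boundary_zero_set_null p q (f : 'cV[R]_p -> 'cV[R]_q) :
  analytic_ae f -> measure_zero (boundary (zero_set f)).
Proof.
move=> [U [oU U0 fU]].
apply: (@measure_zeroS _ _ _ (~` U `|` (boundary (zero_set f) `&` U))).
  by move=> x bx; have [Ux|nUx] := pselect (U x); [right|left].
apply: measure_zeroU => //; apply: measure_zero_local => x [[_ nint] Ux].
have [r [M [r0 pf]]] := analytic_at_pseries (fU x Ux).
(* any s with 3 * s < r would do *)
pose s := r / 4.
have s0 : 0 < s by rewrite divr_gt0.
have sr : 3 * s < r by rewrite /s; lra.
have [i [y ys fy]] : exists i, exists2 y, polydisc s y & f (x + y) i ord0 != 0.
  apply: contrapT => /forallNP h; apply: nint.
  apply/nbhs_polydisc; exists s => // z zs.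
  apply/colP => i; rewrite mxE; apply: contrapT => fz.
  apply: (h i); exists (z - x) => //.
  by rewrite addrCA subrr addr0; apply/eqP.
exists [set z | polydisc s (z - x)]; first exact: near_polydisc.
apply: measure_zeroS (pseries_zeros_null x s0 sr (pf i) _); last by exists y.
move=> z [[[cz _] Uz] zs]; split=> //.
rewrite addrCA subrr addr0.
suff -> : f z = 0 by rewrite mxE.
have fc := analytic_at_continuous (fU z Uz).
apply/eqP; apply: contrapT => /negP fz.
have /cz [w [fw1 fw2]] : nbhs z (f @^-1` [set~ 0]).
  apply: fc; apply: open_nbhs_nbhs; split; last exact/eqP.
  by apply: closed_openC; apply: accessible_closed_set1; exact: hausdorff_accessible.
exact: fw2.
Qed.

End ZeroSet.

(** * Null sets under linear maps *)

Section Linear.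
Variable R : realType.
Notation MR := (measurableTypeR R).
Notation leb := (@lebesgue_measure R).

Lemma measurable_affine (c d : R) :
  measurable_fun [set: MR] (fun x : MR => x * c + d : MR).
Proof.
apply: measurable_funD => //; apply: measurable_funM => //.
Qed.

Lemma negligible_opp (E : set MR) :
  leb.-negligible E -> leb.-negligible [set x : MR | E (- x)].
Proof.
move=> [B [mB B0 EB]]; exists [set x : MR | B (- x)]; split.
- by rewrite -[X in measurable X]setTI; apply: (@oppr_measurable R setT).
- by rewrite -B0 -(lebesgue_measureN mB).
- by move=> x /= /EB.
Qed.

(** The image of Lebesgue measure under x |-> x c + d, times c, gives the right
    measure to intervals, so it is Lebesgue measure. *)
Lemma negligible_affine_pos (E : set MR) (c d : R) : 0 < c ->
  leb.-negligible E -> leb.-negligible [set x : MR | E (x * c + d)].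
Proof.
move=> c0 [B [mB B0 EB]].
pose f (x : MR) : MR := x * c + d.
pose g (x : MR) : MR := x * c^-1 + (- (d / c)).
have fK : cancel f g.
  by move=> x; rewrite /f /g; field; rewrite gt_eqF.
have mf : measurable_fun [set: MR] f by exact: measurable_affine.
have mg : measurable_fun [set: MR] g by exact: measurable_affine.
have [nu nuE] :=
  pushforward_sigma_finite mf mg fK (sigma_finiteT (@lebesgue_measure R)).
pose m := mscale (NngNum (ltW c0)) nu.
have mA (A : set MR) : m A = (c%:E * leb (f @^-1` A))%E.
  by rewrite /m /mscale -[X in (_ * X)%E]/((nu : set MR -> \bar R) A) nuE.
have mE : forall A, measurable A -> leb A = m A.
  apply: lebesgue_measure_unique => _ [[a b] _ <-] /=.
  apply: (etrans _ (esym (mA `]a, b]%classic))) => /=.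
  have -> : f @^-1` `]a, b]%classic = `](a - d) / c, (b - d) / c]%classic.
    apply/seteqP; split=> x /=; rewrite !in_itv /= /f ltr_pdivrMr// ler_pdivlMr//.
      by rewrite ltrBlDr lerBrDr.
    by rewrite ltrBlDr lerBrDr.
  rewrite (lebesgue_measure_itv `]a, b]).
  rewrite (lebesgue_measure_itv `](a - d) / c, (b - d) / c]) /= !lte_fin.
  rewrite ltr_pM2r ?invr_gt0// ltrD2r.
  case: ifP => _; last by rewrite mule0.
  by rewrite -!EFinB -EFinM; congr (_%:E); field; rewrite gt_eqF.
exists (f @^-1` B); split.
- by rewrite -[X in measurable X]setTI; exact: mf.
- have := mE _ mB; rewrite B0 mA => /esym/eqP.
  by rewrite mule_eq0 eqe gt_eqF//= => /eqP.
- by move=> x /= /EB.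
Qed.

Lemma negligible_affine (E : set MR) (c d : R) : c != 0 ->
  leb.-negligible E -> leb.-negligible [set x : MR | E (x * c + d)].
Proof.
move=> cn0 E0; have [c0|c0] := ltP 0 c; first exact: negligible_affine_pos.
have nc : 0 < - c by rewrite oppr_gt0 lt_neqAle cn0.
have := negligible_opp (negligible_affine_pos d nc E0).
by apply: negligibleS => x /=; rewrite mulrNN.
Qed.

Definition dotv n (w v : 'cV[R]_n) : R := \sum_j w j ord0 * v j ord0.

Lemma dotv_cons_cv n x (y : 'cV[R]_n) v :
  dotv (cons_cv x y) v = x * v ord0 ord0 + dotv y (behead_cv v).
Proof.
rewrite /dotv big_ord_recl cons_cv0; congr (_ + _).
by apply: eq_bigr => i _; rewrite cons_cvS mxE.
Qed.

(** Slice along the first coordinate of w.  If v has a nonzero coordinate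
    further on, every slice is null by induction, applied to a translate of E;
    otherwise w.v only depends on the first coordinate of w. *)
Lemma dotv_null n (v : 'cV[R]_n) (E : set MR) : v != 0 ->
  leb.-negligible E -> measure_zero [set w | E (dotv w v)].
Proof.
elim: n v E => [|n IH] v E v0 [B [mB B0 EB]].
  by move: v0; rewrite (_ : v = 0) ?eqxx//; apply/colP => -[].
have mA : measurable_cv [set w : 'cV[R]_n.+1 | B (dotv w v)].
  rewrite /measurable_cv -[X in measurable X]setTI.
  apply: (_ : measurable_fun setT
    (fun t : n.+1.-tuple MR => dotv (cv_of_tuple t) v : MR)) => //.
  apply: measurable_sum => j; apply: measurable_funM => //.
  exact: measurable_coord.
apply: (@measure_zeroS _ _ _ [set w | B (dotv w v)]).
  by move=> w /= /EB.
have {B0 EB}B0 : leb.-negligible B by exists B; split.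
apply/(measure_zero_fubini mA).
(* only the first coordinate of v is nonzero, or some later one is *)
have [v'0|v'0] := eqVneq (behead_cv v) 0.
  have vh : v ord0 ord0 != 0.
    apply: contraNneq v0 => h; apply/eqP/colP => i; rewrite mxE.
    have [k ->|->//] := unliftP ord0 i.
    by move/colP: v'0 => /(_ k); rewrite !mxE.
  apply: negligibleS (negligible_affine 0 vh B0) => x /= nx.
  apply: contrapT => nB; apply: nx; apply: measure_zeroS (measure_zero0 R n) => y /=.
  rewrite dotv_cons_cv v'0 (_ : dotv y 0 = 0)//.
  by rewrite /dotv big1// => j _; rewrite mxE mulr0.
apply: negligibleS (negligible_set0 leb) => x /= nx; apply: nx.
have Bx : leb.-negligible [set u : MR | B (u * 1 + x * v ord0 ord0)].
  by apply: negligible_affine => //; exact: oner_neq0.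
apply: measure_zeroS (IH _ _ v'0 Bx) => y /=.
by rewrite dotv_cons_cv mulr1 addrC.
Qed.

Lemma index_allpairs (S T : eqType) (s : seq S) (t : seq T) x y :
  x \in s -> y \in t ->
  index (x, y) [seq (a, b) | a <- s, b <- t] = (index x s * size t + index y t)%N.
Proof.
elim: s => //= a s IH; rewrite inE eq_sym => xs yt.
rewrite index_cat.
have inj : injective (pair a : T -> S * T) by move=> u w [].
have [ax|ax] := eqVneq a x.
  by rewrite -ax mem_map// yt index_map// mul0n.
rewrite ifN; last by apply/mapP => -[b _ [e _]]; rewrite e eqxx in ax.
rewrite (negbTE ax) /= in xs.
by rewrite size_map IH// mulSn addnA.
Qed.

(** The enumeration of a product type is lexicographic, so [vec_mx] fills a
    matrix row by row. *)
Lemma mxvec_indexE m n (i : 'I_m) (j : 'I_n) :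
  mxvec_index i j = (i * n + j)%N :> nat.
Proof.
rewrite /=; set r := enum_rank (i, j).
have <- : index (i, j) (enum (predT : pred ('I_m * 'I_n))) = r.
  rewrite -{1}(nth_enum_rank (i, j) (i, j)) index_uniq ?enum_uniq//.
  by rewrite -cardE ltn_ord.
rewrite enumT unlock /= /prod_enum index_allpairs ?mem_enum//.
by rewrite !index_enum_ord size_enum_ord.
Qed.

End Linear.

(** * One layer of the network *)

Section Layer.
Variable R : realType.
Notation MR := (measurableTypeR R).
Notation leb := (@lebesgue_measure R).

Lemma measurable_cv_preimage p q (L : 'cV[R]_p -> 'cV[R]_q) (E : set 'cV[R]_q) :
  (forall i, measurable_fun [set: p.-tuple MR]
    (fun t => L (cv_of_tuple t) i ord0 : MR)) ->
  measurable_cv E -> measurable_cv (L @^-1` E).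
Proof.
move=> mL mE.
pose h (t : p.-tuple MR) : q.-tuple MR :=
  [tuple L (cv_of_tuple t) i ord0 : MR | i < q].
rewrite /measurable_cv.
have -> : @cv_of_tuple R p @^-1` (L @^-1` E) = h @^-1` (@cv_of_tuple R q @^-1` E).
  suff hE t : cv_of_tuple (h t) = L (cv_of_tuple t).
    by apply/seteqP; split=> t /=; rewrite hE.
  by apply/colP => i; rewrite mxE tnth_mktuple.
have mh : measurable_fun [set: p.-tuple MR] h.
  apply/measurable_fun_tnthP => i.
  have -> : (@tnth q MR ^~ i) \o h = (fun t => L (cv_of_tuple t) i ord0 : MR).
    by apply/funext => t /=; rewrite tnth_mktuple.
  exact: mL.
by rewrite -[X in measurable X]setTI; exact: mh.
Qed.

Definition matvec m n (W : 'cV[R]_(m * n)) (v : 'cV[R]_n) : 'cV[R]_m :=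
  (vec_mx W^T : 'M[R]_(m, n)) *m v.

Lemma matvecE m n (W : 'cV[R]_(m * n)) (v : 'cV[R]_n) i :
  matvec W v i ord0 = \sum_j W (mxvec_index i j) ord0 * v j ord0.
Proof. by rewrite mxE; apply: eq_bigr => j _; rewrite !mxE. Qed.

Lemma matvec0 m n (W : 'cV[R]_(m * n)) : matvec W (0 : 'cV_n) = 0.
Proof. exact: mulmx0. Qed.

Lemma matvec_col_mx m n (w : 'cV[R]_n) (W : 'cV[R]_(m * n)) v :
  matvec (col_mx w W : 'cV[R]_(m.+1 * n)) v = cons_cv (dotv w v) (matvec W v).
Proof.
apply/colP => i; rewrite matvecE.
have [k ->|->] := unliftP ord0 i.
  rewrite cons_cvS matvecE; apply: eq_bigr => j _; congr (_ * _).
  rewrite mxE; case: splitP => l e;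
    have := etrans (esym e) (mxvec_indexE (lift ord0 k) j);
    rewrite lift0 mulSn -addnA => {}e.
    by exfalso; have := ltn_ord l; rewrite e ltnNge leq_addr.
  congr (W _ _); apply/val_inj; rewrite /= -[RHS]/(nat_of_ord (mxvec_index k j)).
  by rewrite mxvec_indexE; exact: (addnI e).
rewrite cons_cv0; apply: eq_bigr => j _; congr (_ * _).
rewrite mxE; case: splitP => l e;
  have := etrans (esym e) (mxvec_indexE (@ord0 m) j); rewrite mul0n add0n => {}e.
  by congr (w _ _); apply/val_inj.
by exfalso; have := ltn_ord j; rewrite -e ltnNge leq_addr.
Qed.

Lemma measurable_cv_matvec m n (v : 'cV[R]_n) (E : set 'cV[R]_m) :
  measurable_cv E -> measurable_cv [set W | E (matvec W v)].
Proof.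
apply: measurable_cv_preimage => i; under eq_fun do rewrite matvecE.
apply: measurable_sum => j; apply: measurable_funM => //.
exact: measurable_coord.
Qed.

(** The first row of W determines the first coordinate of W v, and the other
    rows the other coordinates; so slice E along its first coordinate and W
    along its first row. *)
Lemma matvec_null m n (v : 'cV[R]_n) (E : set 'cV[R]_m) : v != 0 ->
  measure_zero E -> measure_zero [set W | E (matvec W v)].
Proof.
move=> v0; elim: m E => [|m IH] E /measure_zero_hull [B [mB B0 EB]];
  apply: (@measure_zeroS _ _ _ [set W | B (matvec W v)]); try by move=> W /= /EB.
  by apply: measure_zeroS (measure_zero0 R _) => W /= /(measure_zero_dim0 B0).
have BE := B0; move/(measure_zero_fubini mB): BE => BE.
apply: (@measure_zero_prod R n (m * n) _ _
  (measurable_cv_matvec v mB) (dotv_null v0 BE)).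
move=> w /= /contrapT Bw.
apply: measure_zeroS (IH _ Bw) => W /=.
by rewrite matvec_col_mx.
Qed.

Lemma nbhs_usubmx p q (w : 'cV[R]_(p + q)) (A : set 'cV[R]_p) :
  nbhs (usubmx w) A -> nbhs w [set x | A (usubmx x)].
Proof.
move=> /nbhs_polydisc [r r0 rA]; apply/nbhs_polydisc; exists r => // x xr.
by apply: rA => i; have := xr (lshift q i); rewrite !mxE.
Qed.

Lemma analytic_at_matvec p m n (f : 'cV[R]_p -> 'cV[R]_n)
    (w : 'cV[R]_(p + m * n)) : analytic_at f (usubmx w) ->
  analytic_at (fun x : 'cV[R]_(p + m * n) => matvec (dsubmx x) (f (usubmx x))) w.
Proof.
move=> /analytic_at_pseries [r [M [r0 pf]]]; apply: pseries_analytic_at => i.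
exists r, (\sum_(j < n) (`|dsubmx w (mxvec_index i j) ord0| + r) * M).
pose g j (y : 'cV[R]_(p + m * n)) :=
  (dsubmx w (mxvec_index i j) ord0 + y (rshift p (mxvec_index i j)) ord0) *
  f (usubmx w + \col_k y (lshift (m * n) k) ord0) j ord0.
apply: (@eq_pseries _ _ _ _ (fun y => \sum_j g j y)).
  move=> y _; rewrite matvecE; apply: eq_bigr => j _; rewrite /g !mxE.
  congr (_ * f _ _ _).
  by apply/colP => k; rewrite !mxE.
apply: pseries_sum => // j; apply: pseriesM.
  by apply: pseriesD; [exact: pseries_const|exact: pseries_coord].
apply: (pseries_comp (pf j) r0 (g := fun k y => y (lshift (m * n) k) ord0)) => k.
exact: pseries_coord.
Qed.

(** Good parameters w = (W', W) are of two kinds: f is analytic and nonzero at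
    W' and s is analytic at W f(W'); or f vanishes near W', so that the layer is
    locally the constant s 0.  The first factor W' of a bad w is either a bad
    point of f or on the boundary of its zero set, or else nonzero under f, with
    W in the preimage of a null set under W |-> W f(W'). *)
Lemma analytic_ae_layer p m n (f : 'cV[R]_p -> 'cV[R]_n)
    (s : 'cV[R]_m -> 'cV[R]_m) : analytic_ae f -> analytic_ae s ->
  analytic_ae (fun w : 'cV[R]_(p + m * n) => s (matvec (dsubmx w) (f (usubmx w)))).
Proof.
move=> fae; have bnull := boundary_zero_set_null fae.
case: fae => [U [oU U0 fU]] [V [oV V0 sV]].
pose F (w : 'cV[R]_(p + m * n)) := matvec (dsubmx w) (f (usubmx w)).
pose O := [set w : 'cV[R]_(p + m * n) |
  [/\ U (usubmx w), f (usubmx w) <> 0 & V (F w)] \/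
  interior (zero_set f) (usubmx w)].
have oO : open O.
  rewrite openE => w /= [[Uw fw Vw]|Zw]; last first.
    have : nbhs w [set x | (interior (zero_set f)) (usubmx x)].
      by apply: nbhs_usubmx; exact: nbhs_interior.
    by apply: filterS => x Zx; right.
  have Fc := analytic_at_continuous (analytic_at_matvec (fU _ Uw)).
  have h1 : nbhs w [set x | V (F x)].
    by apply: (Fc V); exact: open_nbhs_nbhs.
  have h2 : nbhs w [set x | U (usubmx x)].
    by apply: nbhs_usubmx; exact: open_nbhs_nbhs.
  have h3 : nbhs w [set x | f (usubmx x) <> 0].
    apply: (@nbhs_usubmx _ _ w [set x | f x <> 0]).
    have fc := analytic_at_continuous (fU _ Uw); apply: (fc [set~ 0]).
    apply: open_nbhs_nbhs; split; last exact: fw.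
    apply: closed_openC; apply: accessible_closed_set1.
    exact: hausdorff_accessible.
  by apply: filterS3 h1 h2 h3 => x ? ? ?; left.
exists O; split=> //.
- have mO : measurable_cv (~` O) by apply: measurable_cvC; exact: measurable_cv_open.
  apply: (measure_zero_prod mO (measure_zeroU U0 bnull)) => x nx.
  have Ux : U x by apply: contrapT => h; apply: nx; left.
  have [fx|fx] := pselect (f x = 0).
    have Zx : interior (zero_set f) x.
      apply: contrapT => h; apply: nx; right; split=> //.
      exact: subset_closure.
    apply: measure_zeroS (measure_zero0 R _) => y /= nO; apply: nO.
    by right; rewrite col_mxKu.
  have fx0 : f x != 0 by exact/eqP.
  apply: measure_zeroS (matvec_null fx0 V0) => y /= nO nV; apply: nO; left.
  by rewrite /F col_mxKu col_mxKd; split.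
move=> w [[Uw fw Vw]|Zw].
  exact: analytic_at_comp (analytic_at_matvec (fU _ Uw)) (sV _ Vw).
apply: analytic_at_ext (analytic_at_cst (s 0) w).
have : nbhs w [set x | zero_set f (usubmx x)] by exact: nbhs_usubmx.
by apply: filterS => x /= fx; rewrite fx matvec0.
Qed.

End Layer.

Theorem proposition6 (R : realType) (D : nat) (n : nat -> nat)
    (sigma : forall i : nat, 'cV[R]_(n i) -> 'cV[R]_(n i))
    (alpha : 'cV[R]_(n 0%N))
    (D_gt0 : (0 < D)%N)
    (n_gt0 : forall i : nat, (i <= D)%N -> (0 < n i)%N)
    (sigma_analytic : forall i : nat, (1 <= i <= D)%N -> analytic_ae (@sigma i)) :
  analytic_ae (@network R n sigma alpha D) /\
  measure_zero (boundary (zero_set (@network R n sigma alpha D))).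
Proof.
suff h : analytic_ae (@network R n sigma alpha D).
  by split=> //; exact: boundary_zero_set_null.
have : forall d, (d <= D)%N -> analytic_ae (@network R n sigma alpha d).
  elim=> [_|d IH dD].
    exists setT; split; [exact: openT| |by move=> a _; exact: analytic_at_cst].
    by rewrite setCT; exact: measure_zero0.
  have sd : analytic_ae (@sigma d.+1) by apply: sigma_analytic.
  exact: (analytic_ae_layer (IH (ltnW dD)) sd).
by apply.
Qed.
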